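(* Let $n \geq m+2$, $p \geq s + 1$, and $\varepsilon\in\{0, 1,-1\}$. Then the moduli space of isometric immersions between space forms of the same constant curvature $$\mathcal{M}\left(\mathbb{M}^{m}_{s}(\varepsilon),\mathbb{M}^{n}_{p}(\varepsilon)\right)$$ is a non-Hausdorff space.
   Context: $m,n$ are positive integers. $\mathbb{E}^{n}_{p}$ is $\mathbb{R}^n$ with the metric $\langle\cdot,\cdot\rangle_p=-\sum_{i=1}^{p}dx_i^2+\sum_{j=p+1}^{n}dx_j^2$. The space forms are $\mathbb{M}^n_p(0)=\mathbb{E}^n_p$, $\mathbb{M}^n_p(1)=\mathbb{S}^n_p(1)=\{x\in\mathbb{E}^{n+1}_p\mid\langle x,x\rangle_p=1\}$, and $\mathbb{M}^n_p(-1)=\mathbb{H}^n_p(-1)=\{x\in\mathbb{E}^{n+1}_{p+1}\mid\langle x,x\rangle_{p+1}=-1\}$, with the induced metrics; the lower index is the index of the metric. For pseudo-Riemannian manifolds $(M,g)$, $(\bar M,\bar g)$, consider the space $\{\phi\in C^\infty(M,\bar M)\mid\phi^*\bar g=g\}$ of isometric immersions, with the compact-open $C^\infty$-topology. The isometry group of $\bar M$ acts on it by composition; the quotient space is the moduli space $\mathcal{M}(M,\bar M)$ of isometric immersions.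
   Formalization: The formal theorem adds the hypothesis n − p > m − s (a spacelike normal direction); without it the claim fails: for n − p < m − s there are no isometric immersions, so the moduli space is empty, and for n − p = m − s it is Hausdorff. *)

(* Defs.v *)
From HB Require Import structures.
From mathcomp Require Import all_boot all_order all_algebra.
From mathcomp Require Import all_classical all_reals all_analysis.
Import Order.TTheory GRing.Theory Num.Theory.
Import numFieldNormedType.Exports.

Set Implicit Arguments.
Unset Strict Implicit.
Unset Printing Implicit Defensive.

Local Open Scope classical_set_scope.
Local Open Scope ring_scope.

Section Smooth.
Context {R : realType}.

Definition iter_derive {V W : normedModType R} (vs : seq V) (f : V -> W) :
    V -> W :=
  foldr (fun v g => 'D_v g) f vs.

(* For U open (the only use below) this is C^oo on U: every iterated
   directional derivative exists and is differentiable, hence continuous. *)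
Definition smooth_on {V W : normedModType R} (U : set V) (f : V -> W) : Prop :=
  forall (vs : seq V) (x : V), U x -> differentiable (iter_derive vs f) x.

Definition partial {d N : nat} (I : seq 'I_d) (f : 'rV[R]_d -> 'rV[R]_N) :
    'rV[R]_d -> 'rV[R]_N :=
  iter_derive [seq delta_mx ord0 i | i <- I] f.

(* The scalar product of R^N whose first q coordinates are negative. *)
Definition pdot {N : nat} (q : nat) (x y : 'rV[R]_N) : R :=
  \sum_(i < N) (-1) ^+ (i < q)%N * (x ord0 i * y ord0 i).

End Smooth.

(* A subset of R^sub_amb with the metric induced by pdot sub_idx.  The notions
   below are the usual ones when sub_set is an embedded submanifold of
   dimension sub_dim on which the induced metric is nondegenerate; the only
   instances used are the space forms, for which this holds. *)
Record submfd (R : realType) := Submfd {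
  sub_amb : nat;
  sub_dim : nat;
  sub_idx : nat;
  sub_set :> set 'rV[R]_sub_amb }.

Section Maps.
Context {R : realType}.
Implicit Types M N : submfd R.

(* A diffeomorphism between the open subset M `&` chart_nbhd of M and the open
   subset chart_img of R^dim; the values of chart_coord outside chart_nbhd and
   of chart_param outside chart_img are irrelevant. *)
Record chart M := Chart {
  chart_nbhd : set 'rV[R]_(sub_amb M);
  chart_img : set 'rV[R]_(sub_dim M);
  chart_coord : 'rV[R]_(sub_amb M) -> 'rV[R]_(sub_dim M);
  chart_param : 'rV[R]_(sub_dim M) -> M;
  chart_nbhd_open : open chart_nbhd;
  chart_img_open : open chart_img;
  chart_coord_smooth : smooth_on chart_nbhd chart_coord;
  chart_param_smooth : smooth_on chart_img (fun w => \val (chart_param w));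
  chart_coord_img :
    forall x : M, chart_nbhd (\val x) -> chart_img (chart_coord (\val x));
  chart_param_nbhd :
    forall w, chart_img w -> chart_nbhd (\val (chart_param w));
  chart_coordK :
    forall x : M, chart_nbhd (\val x) -> chart_param (chart_coord (\val x)) = x;
  chart_paramK :
    forall w, chart_img w -> chart_coord (\val (chart_param w)) = w }.

(* Locally the restriction of a smooth map between open subsets of the
   ambient spaces. *)
Definition smooth_map {M N} (f : M -> N) : Prop :=
  forall x : M, exists (O : set 'rV[R]_(sub_amb M))
                       (F : 'rV[R]_(sub_amb M) -> 'rV[R]_(sub_amb N)),
    [/\ open O, O (\val x), smooth_on O F
      & forall y : M, O (\val y) -> F (\val y) = \val (f y)].

Definition smooth_curve {M} (g : R -> M) : Prop :=
  exists I : set R^o,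
    [/\ open I, I 0 & smooth_on I (fun t : R^o => \val (g t))].

Definition velocity {M} (g : R -> M) : 'rV[R]_(sub_amb M) :=
  derive1 (fun t : R => \val (g t)) 0.

(* The pullback by f of the metric of N is the metric of M.  Tangent vectors
   at x are velocities of smooth curves g with g 0 = x, and the differential
   of f sends the velocity of g to that of f \o g. *)
Definition isometric {M N} (f : M -> N) : Prop :=
  forall g h : R -> M, smooth_curve g -> smooth_curve h -> g 0 = h 0 ->
    pdot (sub_idx N) (velocity (f \o g)) (velocity (f \o h)) =
    pdot (sub_idx M) (velocity g) (velocity h).

Definition isometry {M} (a : M -> M) : Prop :=
  [/\ smooth_map a, isometric a
    & exists b : M -> M, [/\ smooth_map b, cancel a b & cancel b a]].

Definition Cinfty M N : Type := {f : M -> N | smooth_map f}.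

HB.instance Definition _ M N := gen_eqMixin (Cinfty M N).
HB.instance Definition _ M N := gen_choiceMixin (Cinfty M N).

Definition in_charts {M N} (c : chart M) (c' : chart N) (f : M -> N) :
    'rV[R]_(sub_dim M) -> 'rV[R]_(sub_dim N) :=
  fun w => chart_coord c' (\val (f (chart_param c w))).

(* The maps g carrying the compact set K, contained in the domain of c, into
   the domain of c', and whose partial derivatives of order <= r in these
   charts are e-close to those of f on K. *)
Definition Cinfty_subbasic {M N} (f : Cinfty M N) (c : chart M) (c' : chart N)
    (K : set 'rV[R]_(sub_dim M)) (r : nat) (e : R) : set (Cinfty M N) :=
  [set g | (forall w, K w -> chart_nbhd c' (\val (sval g (chart_param c w)))) /\
    forall (I : seq 'I_(sub_dim M)) w, (size I <= r)%N -> K w ->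
      `| partial I (in_charts c c' (sval g)) w
         - partial I (in_charts c c' (sval f)) w | < e].

Definition Cinfty_subbase M N : set_system (Cinfty M N) :=
  [set A | exists f c c' K r e,
    [/\ compact K, K `<=` chart_img c,
        (forall w, K w -> chart_nbhd c' (\val (sval f (chart_param c w)))),
        0 < e
      & A = Cinfty_subbasic f c c' K r e]].

(* The compact-open C^oo topology. *)
HB.instance Definition _ M N :=
  isSubBaseTopological.Build (Cinfty M N) (@Cinfty_subbase M N) id.

(* Carries the subspace topology. *)
Definition isometric_immersions M N : topologicalType :=
  set_type [set f : Cinfty M N | isometric (sval f)].

Definition imm_fun {M N} (f : isometric_immersions M N) : M -> N :=
  sval (\val f).

Definition orbit_of {M N} (f : isometric_immersions M N) :
    set (isometric_immersions M N) :=
  [set g | exists2 a : N -> N, isometry a & imm_fun g = a \o imm_fun f].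

Definition orbit_space M N : Type :=
  {C : set (isometric_immersions M N) | exists f, C = orbit_of f}.

HB.instance Definition _ M N := gen_eqMixin (orbit_space M N).
HB.instance Definition _ M N := gen_choiceMixin (orbit_space M N).

Definition orbit_pi M N (f : isometric_immersions M N) : orbit_space M N :=
  exist _ (orbit_of f) (ex_intro _ f erefl).

Definition orbit_repr M N (C : orbit_space M N) : isometric_immersions M N :=
  sval (cid (svalP C)).

Lemma orbit_reprK M N : cancel (@orbit_repr M N) (@orbit_pi M N).
Proof.
move=> C; apply: eq_sig_hprop => [?|/=]; first exact: Prop_irrelevance.
by rewrite /orbit_repr; case: cid => f /= ->.
Qed.

HB.instance Definition _ M N :=
  isQuotient.Build (isometric_immersions M N : Type) (orbit_space M N)
    (@orbit_reprK M N).

Definition moduli_space M N : topologicalType :=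
  quotient_topology (orbit_space M N : quotType (isometric_immersions M N)).

End Maps.

(* The n-dimensional space form of index p and curvature eps; meaningful for
   eps = 0, 1, -1 and p <= n. *)
Definition space_form (R : realType) (n p : nat) (eps : int) : submfd R :=
  let N := if eps == 0 then n else n.+1 in
  let q := if eps == -1 then p.+1 else p in
  @Submfd R N n q
    (if eps == 0 then setT else [set x : 'rV[R]_N | pdot q x x = eps%:~R]).

(* Main.v *)
From HB Require Import structures.
Require Import Defs.
From mathcomp Require Import all_boot all_order all_algebra.
From mathcomp Require Import all_classical all_reals all_analysis.
From mathcomp Require Import zify ring.
Import Order.TTheory GRing.Theory Num.Theory.
Import numFieldNormedType.Exports.

Set Implicit Arguments.
Unset Strict Implicit.
Unset Printing Implicit Defensive.

(** Let [J] be the linear totally geodesic inclusion and [xi] a null vector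
    orthogonal to its image, which exists because the codimension has both a
    negative and a positive direction.  Then [f_c x = J x + c x_l^2 xi] is an
    isometric immersion for every [c].  An ambient boost fixes the image of [J]
    and maps [xi] to [c xi], so all [f_c] with [c > 0] are congruent; as
    [f_c --> J] when [c --> 0], the class of [f_1] lies in every neighbourhood
    of the class of [J].
    The two classes differ: an isometry [a] of the target extends to a map [A]
    homogeneous of degree one, which is an isometry of a flat open set, whence
    [D_v (D_v A) = 0]; but [f_1 = a \o J] makes [D_v (D_v A)] equal to [2 xi]
    at a point of [J M] with [x_l = 0], for [v] the [J]-image of the l-th basis
    vector. *)

(** * Smooth maps *)

Section SmoothCalculus.
Local Open Scope classical_set_scope.
Local Open Scope ring_scope.
Context {R : realType}.
Implicit Types V W : normedModType R.

(** The difference [g - f] vanishes near [x], so the zero map satisfies the expansion that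
    characterizes its differential there. *)
Lemma near_eq_differentiable V W (f g : V -> W) x :
  (\near x, f x = g x) -> differentiable f x -> differentiable g x.
Proof.
move=> fg df; rewrite (_ : g = f + (g - f)); last first.
  by apply/funext => y /=; rewrite /GRing.add /= addrC subrK.
apply: (differentiableD df).
set e := g - f; have e0 : \near x, e x = 0.
  by near=> y; rewrite /e /GRing.add/= /GRing.opp/= (near fg y _)// subrr.
pose z : {linear V -> W} := 'd (cst (0 : W)) x.
have z0 : z = 0 :> (V -> W) by rewrite /z diff_cst.
have eo : e \o shift x = cst (e x) + z +o_ 0 id.
  apply/eqaddoP => _/posnumP[c].
  rewrite (nbhs_singleton e0).
  have : \forall y \near 0, e (y + x) = 0.
    by move: e0; rewrite (near_shift 0 x) subr0.
  move=> h.
  near=> y.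
  rewrite z0 !fctE /= addr0 subr0.
  have -> : e (y + x) = 0 by near: y.
  by rewrite normr0 mulr_ge0.
apply/diff_locallyP.
have c0 : continuous z by rewrite z0 => ?; exact: cst_continuous.
have dz := diff_unique c0 eo.
by rewrite dz; split.
Unshelve. all: by end_near. Qed.

(** A finite-order form of [smooth_on], graded so that closure properties go by induction on the
    order. [Ck 0] already demands differentiability, so under [Ck k] the iterated derivatives of
    order up to [k] are all differentiable. *)
Fixpoint Ck V W (k : nat) (U : set V) (f : V -> W) : Prop :=
  (forall x, U x -> differentiable f x) /\
  (if k is j.+1 then forall v, Ck j U ('D_v f) else True).

Lemma Ck_diff V W k U (f : V -> W) x : Ck k U f -> U x -> differentiable f x.
Proof. by case: k => [|k] [h _]; exact: h. Qed.

Lemma Ck_derive V W k U (f : V -> W) v : Ck k.+1 U f -> Ck k U ('D_v f).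
Proof. by move=> /= []. Qed.

(** Lists of directions are peeled from the right, because the last entry of [vs] is the direction
    differentiated first. *)
Lemma smooth_onP V W U (f : V -> W) : smooth_on U f <-> forall k, Ck k U f.
Proof.
split=> [+ k|].
  elim: k f => [|k IH] f sf; first by split=> // x /(sf [::]).
  split=> [x /(sf [::])//|v]; apply: IH => vs x.
  have -> : iter_derive vs ('D_v f) = iter_derive (rcons vs v) f.
    by rewrite /iter_derive -cats1 foldr_cat.
  exact: sf.
move=> + vs x Ux; elim/last_ind: vs f => [|vs v IH] f Cf.
  exact: Ck_diff (Cf 0%N) Ux.
have -> : iter_derive (rcons vs v) f = iter_derive vs ('D_v f).
  by rewrite /iter_derive -cats1 foldr_cat.
by apply: IH => k; apply: Ck_derive; exact: Cf.
Qed.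

Lemma Ck_le V W k U (f : V -> W) : Ck k.+1 U f -> Ck k U f.
Proof.
elim: k f => [|k IH] f [df Df]; split=> //.
by move=> v; apply: IH; exact: Df.
Qed.

Lemma open_near_eq V W (U : set V) (f g : V -> W) x : open U ->
  (forall y, U y -> f y = g y) -> U x -> \near x, f x = g x.
Proof.
move=> oU fg Ux; near=> y; apply: fg; near: y.
exact: open_nbhs_nbhs.
Unshelve. all: by end_near. Qed.

Lemma Ck_ext V W k (U : set V) (f g : V -> W) : open U ->
  (forall y, U y -> f y = g y) -> Ck k U f -> Ck k U g.
Proof.
move=> oU; elim: k f g => [|k IH] f g fg [df Df]; split=> //.
- by move=> x Ux; apply: near_eq_differentiable (df x Ux); exact: open_near_eq fg Ux.
- by move=> x Ux; apply: near_eq_differentiable (df x Ux); exact: open_near_eq fg Ux.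
- move=> v; apply: IH (Df v) => y Uy.
  by apply: near_eq_derive; exact: open_near_eq fg Uy.
Qed.

Lemma Ck_sub V W k (U U' : set V) (f : V -> W) : U' `<=` U -> Ck k U f -> Ck k U' f.
Proof.
move=> UU; elim: k f => [|k IH] f [df Df]; split=> //.
- by move=> x /UU; exact: df.
- by move=> x /UU; exact: df.
- by move=> v; apply: IH; exact: Df.
Qed.

Lemma Ck_cst V W k (U : set V) (a : W) : Ck k U (cst a).
Proof.
elim: k a => [|k IH] a; split=> //; try by move=> x _; exact: differentiable_cst.
move=> v; rewrite (_ : 'D_v (cst a) = cst 0); first exact: IH.
by apply/funext => x; rewrite derive_cst.
Qed.

Lemma Ck_linear V W k (U : set V) (f : V -> W) : linear f -> continuous f -> Ck k U f.
Proof.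
move=> fl fc.
pose fM := GRing.isLinear.Build _ _ _ _ _ fl.
pose fL : {linear V -> W} := HB.pack f fM.
have df x : differentiable f x by exact: (@linear_differentiable _ _ _ fL).
have -> : f = fL by [].
case: k => [|k]; split=> //= v.
rewrite (_ : 'D_v f = cst (f v)); first exact: Ck_cst.
apply/funext => x; rewrite deriveE//.
by rewrite (@diff_lin _ _ _ fL).
Qed.

Lemma Ck_add V W k (U : set V) (f g : V -> W) : open U ->
  Ck k U f -> Ck k U g -> Ck k U (f + g).
Proof.
move=> oU; elim: k f g => [|k IH] f g Cf Cg.
  split; [move=> x Ux|by []].
  exact: (@differentiableD _ _ _ f g x (Ck_diff Cf Ux) (Ck_diff Cg Ux)).
split=> [x Ux|v].
  exact: (@differentiableD _ _ _ f g x (Ck_diff Cf Ux) (Ck_diff Cg Ux)).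
apply: (@Ck_ext _ _ _ _ ('D_v f + 'D_v g)) => //; last first.
  by apply: IH; exact: Ck_derive.
move=> y Uy; rewrite (@deriveD _ _ _ f g)//.
  exact: diff_derivable (Ck_diff Cf Uy).
exact: diff_derivable (Ck_diff Cg Uy).
Qed.

Lemma Ck_sum V W k (U : set V) n (f : 'I_n -> V -> W) : open U ->
  (forall i, Ck k U (f i)) -> Ck k U (fun x => \sum_(i < n) f i x).
Proof.
move=> oU; elim: n f => [|n IH] f Cf.
  apply: (@Ck_ext _ _ _ _ (cst 0)) => //; last exact: Ck_cst.
  by move=> y _; rewrite big_ord0.
apply: (@Ck_ext _ _ _ _ ((fun x => \sum_(i < n) f (lift ord0 i) x) + f ord0)) => //.
  by move=> y _; rewrite big_ord_recl addrC.
by apply: Ck_add => //; exact: IH.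
Qed.

Lemma Ck_mul V k (U : set V) (f g : V -> R) : open U ->
  Ck k U f -> Ck k U g -> Ck k U (f * g).
Proof.
move=> oU; elim: k f g => [|k IH] f g Cf Cg; split=> //; try by
  move=> x Ux; apply: differentiableM; [apply: (Ck_diff Cf)|apply: (Ck_diff Cg)].
move=> v; apply: (@Ck_ext _ _ _ _ (f * 'D_v g + g * 'D_v f)) => //; last first.
  by apply: Ck_add => //; apply: IH; (try exact: Ck_le); exact: Ck_derive.
move=> y Uy; rewrite deriveM//; apply: diff_derivable;
  [exact: (Ck_diff Cf)|exact: (Ck_diff Cg)].
Qed.

Lemma differentiable_mx V n (f : V -> 'rV[R]_n) x :
  (forall i, differentiable (fun y => f y ord0 i) x) -> differentiable f x.
Proof.
move=> df; rewrite (_ : f = \sum_(i < n) (fun y => f y ord0 i *: delta_mx ord0 i)).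
  by apply: differentiable_sum => i; exact: differentiableZl.
apply/funext => y; rewrite fct_sumE; exact: row_sum_delta.
Qed.

Lemma derive_coord V n (f : V -> 'rV[R]_n) x v i : differentiable f x ->
  'D_v (fun y => f y ord0 i) x = 'D_v f x ord0 i.
Proof. by move=> df; rewrite derive_mx ?mxE//; exact: diff_derivable. Qed.

Lemma differentiable_coordf V n (f : V -> 'rV[R]_n) x i :
  differentiable f x -> differentiable (fun y => f y ord0 i) x.
Proof.
by move=> df; exact: (differentiable_comp df (differentiable_coord _ _ _)).
Qed.

Lemma Ck_coord V k (U : set V) n (f : V -> 'rV[R]_n) i : open U ->
  Ck k U f -> Ck k U (fun y => f y ord0 i).
Proof.
move=> oU; elim: k f => [|k IH] f Cf; split=> //; try by
  move=> x Ux; apply: differentiable_coordf; exact: (Ck_diff Cf).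
move=> v; apply: (@Ck_ext _ _ _ _ (fun y => 'D_v f y ord0 i)) => //.
  by move=> y Uy; rewrite derive_coord//; exact: (Ck_diff Cf).
by apply: IH; exact: Ck_derive.
Qed.

Lemma Ck_mx V k (U : set V) n (f : V -> 'rV[R]_n) : open U ->
  (forall i, Ck k U (fun y => f y ord0 i)) -> Ck k U f.
Proof.
move=> oU; elim: k f => [|k IH] f Cf.
  by split=> // x Ux; apply: differentiable_mx => i; exact: (Ck_diff (Cf i)).
have df x : U x -> differentiable f x.
  by move=> Ux; apply: differentiable_mx => i; exact: (Ck_diff (Cf i)).
split=> // v; apply: IH => i.
apply: (@Ck_ext _ _ _ _ ('D_v (fun y => f y ord0 i))) => //.
  by move=> y Uy; rewrite derive_coord//; exact: df.
exact: Ck_derive.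
Qed.

Lemma Ck_scale V k (U : set V) n (c : V -> R) (f : V -> 'rV[R]_n) : open U ->
  Ck k U c -> Ck k U f -> Ck k U (fun y => c y *: f y).
Proof.
move=> oU Cc Cf; apply: Ck_mx => // i.
apply: (@Ck_ext _ _ _ _ (c * (fun y => f y ord0 i))) => //.
  by move=> y _; rewrite mxE.
by apply: Ck_mul => //; exact: Ck_coord.
Qed.

Lemma derive_comp V W n (f : V -> 'rV[R]_n) (g : 'rV[R]_n -> W) x v :
  differentiable f x -> differentiable g (f x) ->
  'D_v (g \o f) x = 'D_('D_v f x) g (f x).
Proof.
move=> df dg; rewrite deriveE; last exact: differentiable_comp.
by rewrite diff_comp//= deriveE// deriveE.
Qed.

Lemma derive_row_sum W n (g : 'rV[R]_n -> W) x (v : 'rV[R]_n) :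
  differentiable g x ->
  'D_v g x = \sum_(i < n) v ord0 i *: 'D_(delta_mx ord0 i) g x.
Proof.
move=> dg; rewrite deriveE// {1}(row_sum_delta v) linear_sum.
by apply: eq_bigr => i _; rewrite linearZ/= deriveE.
Qed.

(** The chain rule produces a derivative of [g] in the direction ['D_v f x], which varies with [x].
    Expanding it in the standard basis of the row space leaves sums of products of coordinates of
    ['D_v f] with partial derivatives of [g] composed with [f], to which induction applies. *)
Lemma Ck_comp V k (U : set V) n m (U' : set 'rV[R]_n) (f : V -> 'rV[R]_n)
    (g : 'rV[R]_n -> 'rV[R]_m) : open U ->
  (forall x, U x -> U' (f x)) ->
  Ck k U f -> Ck k U' g -> Ck k U (g \o f).
Proof.
move=> oU UU; elim: k f g UU => [|k IH] f g UU Cf Cg.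
  split=> // x Ux; apply: differentiable_comp.
    exact: (Ck_diff Cf).
  by apply: (Ck_diff Cg); exact: UU.
have df x : U x -> differentiable f x by exact: (Ck_diff Cf).
have dg x : U x -> differentiable g (f x).
  by move=> /UU Ux; exact: (Ck_diff Cg).
split=> [x Ux|v]; first exact: (differentiable_comp (df _ Ux) (dg _ Ux)).
apply: (@Ck_ext _ _ _ _ (fun x => \sum_(i < n)
    'D_v f x ord0 i *: ('D_(delta_mx ord0 i) g \o f) x)) => //.
  move=> y Uy; rewrite derive_comp//; [|exact: df|exact: dg].
  by rewrite [RHS]derive_row_sum//; exact: dg.
apply: Ck_sum => // i; apply: Ck_scale => //.
  by apply: Ck_coord => //; exact: Ck_derive.
by apply: IH => //; [exact: Ck_le|exact: Ck_derive].
Qed.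

(** The derivative is a product of copies of the function itself and of a derivative of [q], so the
    order of smoothness climbs by induction. *)
Lemma Ck_invsqrt V k (U : set V) (q : V -> R) : open U ->
  (forall x, U x -> 0 < q x) -> Ck k U q ->
  Ck k U (fun x => (Num.sqrt (q x))^-1).
Proof.
move=> oU q0; set g := fun x => _; elim: k => [|k IH] Cq.
  split=> // x Ux; apply: differentiableV; last by rewrite gt_eqF// sqrtr_gt0 q0.
  apply: (@differentiable_comp _ _ _ _ q Num.sqrt).
    exact: (Ck_diff Cq).
  by apply/derivable1_diffP; case: (is_derive1_sqrt (q0 _ Ux)).
have Cg : Ck k U g by apply: IH; exact: Ck_le.
have dq x : U x -> differentiable q x by exact: (Ck_diff Cq).
have dg x : U x -> differentiable g x by exact: (Ck_diff Cg).
have gq x : U x -> (g * g * q) x = 1.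
  move=> Ux; rewrite /g !fctE -expr2 exprVn sqr_sqrtr ?ltW ?q0//.
  by rewrite mulVf// gt_eqF// q0.
split=> // v.
apply: (@Ck_ext _ _ _ _ (cst (- 2^-1) * (g * g * g) * 'D_v q)) => //; last first.
  do ![apply: Ck_mul => //]; first exact: Ck_cst.
  exact: Ck_derive.
move=> y Uy.
(* Differentiating g^2 q = 1 gives D_v g = - g^3 D_v q / 2. *)
have : 'D_v (g * g * q) y = 0.
  rewrite (@near_eq_derive _ _ _ _ (cst (1 : R) : V -> R)) ?derive_cst//.
  exact: (open_near_eq oU gq).
have dgy : derivable g y v by apply: diff_derivable; exact: dg.
have dqy : derivable q y v by apply: diff_derivable; exact: dq.
rewrite (deriveM (derivableM dgy dgy) dqy) (deriveM dgy dgy).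
have := gq _ Uy; rewrite !fctE.
have : g y != 0 by rewrite invr_neq0// gt_eqF// sqrtr_gt0 q0.
move: (g y) (q y) ('D_v g y) ('D_v q y) => a b a' b' a0 ab.
rewrite /GRing.scale/= => h.
have b0 : b = (a * a)^-1.
  by apply: (mulfI (x := a * a)); rewrite ?mulf_neq0// ab mulfV// mulf_neq0.
move: h; rewrite b0 => h.
apply/eqP; rewrite -subr_eq0; apply/eqP.
transitivity (- (a / 2) * (a * a * b' + (a * a)^-1 * (a * a' + a * a'))).
  by field.
by rewrite h mulr0.
Qed.

End SmoothCalculus.

(** * Symmetry of second derivatives *)

Section Schwarz.
Local Open Scope classical_set_scope.
Local Open Scope ring_scope.
Context {R : realType}.
Implicit Types V W : normedModType R.

Lemma is_derive_line V W (g : V -> W) (x v : V) (s : R) :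
  derivable g (x + s *: v) v ->
  is_derive s (1 : R) (fun t : R => g (x + t *: v)) ('D_v g (x + s *: v)).
Proof.
have E : (fun h : R => h^-1 *: (((fun t => g (x + t *: v)) \o shift s) (h *: 1)
                      - g (x + s *: v))) =
    (fun h => h^-1 *: ((g \o shift (x + s *: v)) (h *: v) - g (x + s *: v))).
  apply/funext => h /=; congr (_ *: (g _ - _)).
  by rewrite [h *: 1]mulr1 scalerDl addrCA.
by move=> dg; split; rewrite /derivable /derive E.
Qed.

(** The mean value theorem is applied twice: in [s] to [g (x + h w + s v) - g (x + s v)], then in
    [t] to ['D_v g] along [w]. *)
Lemma second_difference V (U : set V) (g : V -> R) x v w (h : R) :
  0 < h -> Ck 2 U g ->
  (forall s t, 0 <= s <= h -> 0 <= t <= h -> U (x + t *: w + s *: v)) ->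
  exists s t, [/\ 0 <= s <= h, 0 <= t <= h &
    g (x + h *: w + h *: v) - g (x + h *: v) - g (x + h *: w) + g x =
    h * h * 'D_w ('D_v g) (x + t *: w + s *: v)].
Proof.
move=> h0 Cg Uh.
have hh : 0 <= h <= h by rewrite ltW//=.
have zh : (0 : R) <= 0 <= h by apply/andP; split=> //; exact: ltW.
have itvW s : s \in `]0, h[ -> 0 <= s <= h.
  by rewrite in_itv/= => /andP[? ?]; rewrite !ltW.
have Uh0 s : 0 <= s <= h -> U (x + s *: v).
  by move=> sh; have := Uh _ _ sh zh; rewrite scale0r addr0.
pose phi s := g (x + h *: w + s *: v) - g (x + s *: v).
have dg y : U y -> derivable g y v.
  by move=> Uy; apply: diff_derivable; exact: (Ck_diff Cg).
have dphi s : 0 <= s <= h -> is_derive s 1 phi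
    ('D_v g (x + h *: w + s *: v) - 'D_v g (x + s *: v)).
  move=> sh.
  have h1 := is_derive_line (dg _ (Uh _ _ sh hh)).
  have h2 := is_derive_line (dg _ (Uh0 _ sh)).
  exact: (is_deriveB h1 h2).
have [s sh phiE] := @MVT R phi (fun s => 'D_v g (x + h *: w + s *: v)
    - 'D_v g (x + s *: v)) 0 h h0 (fun s sh => dphi s (itvW s sh))
  (derivable_within_continuous (fun s (sh : s \in `[0, h]) =>
     @ex_derive _ _ _ _ _ _ _ (dphi s sh))).
have {}sh := itvW _ sh.
pose psi t := 'D_v g (x + s *: v + t *: w).
have dpsi t : 0 <= t <= h -> is_derive t 1 psi
    ('D_w ('D_v g) (x + s *: v + t *: w)).
  move=> th; apply: is_derive_line; apply: diff_derivable.
  by apply: (Ck_diff (Ck_derive v Cg)); rewrite addrAC; exact: Uh.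
have [t th psiE] := @MVT R psi (fun t => 'D_w ('D_v g) (x + s *: v + t *: w))
    0 h h0 (fun s sh => dpsi s (itvW s sh))
  (derivable_within_continuous (fun s (sh : s \in `[0, h]) =>
     @ex_derive _ _ _ _ _ _ _ (dpsi s sh))).
exists s, t; split => //; first exact: itvW.
move: phiE psiE; rewrite /phi /psi !scale0r !addr0 subr0.
rewrite [x + s *: v + h *: w]addrAC [x + s *: v + t *: w]addrAC => + E.
rewrite E => {}E.
rewrite opprB addrA in E.
by rewrite addrAC E -mulrA mulrC.
Qed.

(** The second difference over a small parallelogram is symmetric in [v] and [w], so each mixed
    derivative takes the same value at some point near [x]; continuity of both at [x] concludes. *)
Lemma derive_comm V (U : set V) (g : V -> R) x v w : open U -> Ck 2 U g ->
  U x -> 'D_v ('D_w g) x = 'D_w ('D_v g) x.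
Proof.
move=> oU Cg Ux; apply/eqP; rewrite -subr_eq0 -normr_le0.
apply/ler_addgt0Pl => e e0; rewrite addr0.
set a := 'D_v ('D_w g) x; set b := 'D_w ('D_v g) x.
have e2 : 0 < e / 2 by rewrite divr_gt0.
have cont u u' : \forall y \near x, `|'D_u ('D_u' g) x - 'D_u ('D_u' g) y| < e / 2.
  have Cuu : Ck 0 U ('D_u ('D_u' g)) by do 2! apply: Ck_derive.
  have /cvgrPdist_lt := differentiable_continuous (Ck_diff Cuu Ux).
  by move=> /(_ _ e2).
have oUx : \forall y \near x, U y by exact: open_nbhs_nbhs.
have := cont w v; have := cont v w; rewrite -/a -/b.
move: a b => a b cvw cwv.
have : nbhs x (U `&` ([set y | `|a - 'D_v ('D_w g) y| < e / 2] `&`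
    [set y | `|b - 'D_w ('D_v g) y| < e / 2])).
  by apply: filterI oUx (filterI cvw cwv).
move=> /nbhs_ballP[r /= r0 xr].
(* Small enough for the parallelogram with sides [h v] and [h w] to stay in the ball; the summand 1
   keeps the denominator positive. *)
pose h := r / (`|v| + `|w| + 1).
have c0 : 0 < `|v| + `|w| + 1 by rewrite ltr_wpDl// addr_ge0.
have h0 : 0 < h by rewrite divr_gt0.
have inb s t : 0 <= s <= h -> 0 <= t <= h -> ball x r (x + t *: w + s *: v).
  move=> /andP[s0 sh] /andP[t0 th].
  rewrite -ball_normE /= -addrA opprD addrA subrr sub0r normrN.
  rewrite (le_lt_trans (ler_normD _ _))// !normrZ !ger0_norm//.
  apply: (@le_lt_trans _ _ (h * (`|v| + `|w|))).
    by rewrite mulrDr addrC lerD// ler_wpM2r.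
  by rewrite /h mulrAC ltr_pdivrMr// ltr_pM2l// ltrDl.
have [s [t [sh th E1]]] := second_difference h0 Cg
  (fun s t sh th => (xr _ (inb s t sh th)).1).
have inb' s' t' : 0 <= s' <= h -> 0 <= t' <= h -> ball x r (x + t' *: v + s' *: w).
  by move=> ? ?; rewrite addrAC; exact: inb.
have [s' [t' [sh' th' E2]]] := second_difference h0 Cg
  (fun s t sh th => (xr _ (inb' s t sh th)).1).
have E : 'D_w ('D_v g) (x + t *: w + s *: v) = 'D_v ('D_w g) (x + t' *: v + s' *: w).
  apply: (@mulfI _ (h * h)); first by rewrite mulf_neq0// gt_eqF.
  apply: etrans (esym E1) (etrans _ E2); congr (_ + _).
  by rewrite [x + h *: w + h *: v]addrAC; exact: addrAC.
have [_ [_ hb]] := xr _ (inb _ _ sh th).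
have [_ [ha _]] := xr _ (inb' _ _ sh' th').
move: ha hb => /=; rewrite E; move: ('D_v _ _) => c ha hb.
have -> : a - b = (a - c) - (b - c) by rewrite opprB addrA subrK.
apply: le_trans (ler_normB _ _) _; rewrite (splitr e).
by apply: lerD; exact: ltW.
Qed.

End Schwarz.

(** * Algebra and differential calculus of the scalar product *)

Section ScalarProduct.
Local Open Scope classical_set_scope.
Local Open Scope ring_scope.
Context {R : realType}.

Section Algebra.
Variables (D Q : nat).
Implicit Types x y z : 'rV[R]_D.

Lemma pdotC x y : pdot Q x y = pdot Q y x.
Proof. by apply: eq_bigr => i _; rewrite [x _ _ * _]mulrC. Qed.

Lemma pdotDl x y z : pdot Q (x + y) z = pdot Q x z + pdot Q y z.
Proof.
by rewrite -big_split/=; apply: eq_bigr => i _; rewrite mxE mulrDl mulrDr.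
Qed.

Lemma pdotZl (c : R) x y : pdot Q (c *: x) y = c * pdot Q x y.
Proof.
by rewrite mulr_sumr; apply: eq_bigr => i _; rewrite mxE -mulrA mulrCA.
Qed.

Lemma pdotDr x y z : pdot Q x (y + z) = pdot Q x y + pdot Q x z.
Proof. by rewrite pdotC pdotDl !(pdotC _ x). Qed.

Lemma pdotZr (c : R) x y : pdot Q x (c *: y) = c * pdot Q x y.
Proof. by rewrite pdotC pdotZl pdotC. Qed.

Lemma pdot_lincomb (c1 c2 c3 c4 : R) x y z w :
  pdot Q (c1 *: x + c2 *: y) (c3 *: z + c4 *: w) =
  c1 * (c3 * pdot Q x z + c4 * pdot Q x w) +
  c2 * (c3 * pdot Q y z + c4 * pdot Q y w).
Proof. by rewrite pdotDl !pdotZl !pdotDr !pdotZr. Qed.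

(** Compares two polar decompositions: [x] and [z] are radial, [y], [y'], [w] and [w'] tangential.
    The first alternative serves the flat case, where the radial coefficients vanish. *)
Lemma pdot_polar (c c' r : R) x y y' z w w' :
  pdot Q y y' = pdot Q w w' ->
  (c = 0 /\ c' = 0) \/
  [/\ pdot Q x x = pdot Q z z, pdot Q x y = 0, pdot Q x y' = 0,
     pdot Q z w = 0 & pdot Q z w' = 0] ->
  pdot Q (c *: x + r *: y) (c' *: x + r *: y') =
  pdot Q (c *: z + r *: w) (c' *: z + r *: w').
Proof.
move=> yw; rewrite !pdot_lincomb yw => -[[-> ->]|[xz xy xy' zw zw']].
  by rewrite !mul0r !add0r.
by rewrite xz xy' zw' [pdot Q y x]pdotC xy [pdot Q w z]pdotC zw.
Qed.

Lemma pdot0l x : pdot Q 0 x = 0.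
Proof. by rewrite -(scale0r x) pdotZl mul0r. Qed.

Lemma pdot0r x : pdot Q x 0 = 0.
Proof. by rewrite pdotC pdot0l. Qed.

Lemma pdot_deltar x i :
  pdot Q x (delta_mx ord0 i) = (-1) ^+ (i < Q)%N * x ord0 i.
Proof.
rewrite /pdot (bigD1 i)//= big1 ?addr0; last first.
  by move=> j /negPf ji; rewrite mxE ji andbF mulr0 mulr0.
by rewrite mxE !eqxx mulr1.
Qed.

Lemma pdot_nondegenerate x : (forall y, pdot Q x y = 0) -> x = 0.
Proof.
move=> x0; apply/rowP => i; rewrite mxE.
have /eqP := x0 (delta_mx ord0 i).
by rewrite pdot_deltar mulf_eq0 signr_eq0 /= => /eqP.
Qed.

(** Nondegeneracy makes the isometric square matrix [B] injective, hence invertible, so [x] is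
    orthogonal to every vector. *)
Lemma pdot_isometry_ortho (B : 'M[R]_D) x :
  (forall y z, pdot Q (y *m B) (z *m B) = pdot Q y z) ->
  (forall y, pdot Q x (y *m B) = 0) -> x = 0.
Proof.
move=> Biso xB; apply: pdot_nondegenerate => y.
have Bfree : row_free B.
  rewrite -kermx_eq0; apply/rowV0P => u /sub_kermxP uB.
  by apply: pdot_nondegenerate => z; rewrite -Biso uB pdot0l.
by rewrite -(mulmxKV (_ : B \in unitmx) y) ?xB// -row_free_unit.
Qed.

Lemma pdot_suml n (f : 'I_n -> 'rV[R]_D) y :
  pdot Q (\sum_i f i) y = \sum_i pdot Q (f i) y.
Proof.
elim/big_rec2: _ => [|i a b _ <-]; first exact: pdot0l.
exact: pdotDl.
Qed.

End Algebra.

Section Calculus.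
Variable V : normedModType R.

Lemma derive_scale n (c : V -> R) (f : V -> 'rV[R]_n) x v :
  differentiable c x -> differentiable f x ->
  'D_v (fun y => c y *: f y) x = 'D_v c x *: f x + c x *: 'D_v f x.
Proof.
move=> dc df.
have dcf i : differentiable (fun y => (c y *: f y) ord0 i) x.
  rewrite (_ : (fun y => _) = c * (fun y => f y ord0 i)); last first.
    by apply/funext => y; rewrite mxE.
  by apply: differentiableM => //; exact: differentiable_coordf.
apply/rowP => i; rewrite -derive_coord; last exact: differentiable_mx.
rewrite (_ : (fun y => _) = c * (fun y => f y ord0 i)); last first.
  by apply/funext => y; rewrite mxE.
have dfi := differentiable_coordf i df.
rewrite (deriveM (diff_derivable _) (diff_derivable _))//.
by rewrite derive_coord// !mxE addrC [_ *: 'D_v c x]mulrC.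
Qed.

Lemma derive_pdot n q (f g : V -> 'rV[R]_n) x v :
  differentiable f x -> differentiable g x ->
  'D_v (fun y => pdot q (f y) (g y)) x =
    pdot q ('D_v f x) (g x) + pdot q (f x) ('D_v g x).
Proof.
move=> df dg.
pose h (i : 'I_n) : V -> R := fun y => (-1) ^+ (i < q)%N * (f y ord0 i * g y ord0 i).
have dh (i : 'I_n) : is_derive x v (h i) ((-1) ^+ (i < q)%N *
    ('D_v f x ord0 i * g x ord0 i + f x ord0 i * 'D_v g x ord0 i)).
  have dfi := differentiable_coordf i df.
  have dgi := differentiable_coordf i dg.
  have Hf := derivableP (diff_derivable (v := v) dfi).
  have Hg := derivableP (diff_derivable (v := v) dgi).
  have H := is_deriveZ ((-1) ^+ (i < q)%N) (is_deriveM Hf Hg).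
  apply: is_derive_eq H _.
  rewrite (derive_coord v i df) (derive_coord v i dg) /GRing.scale/=; congr (_ * _).
  by rewrite addrC [X in X + _]mulrC.
rewrite (_ : (fun y => _) = \sum_(i < n) h i); last first.
  by apply/funext => y; rewrite fct_sumE.
rewrite (@derive_val _ _ _ _ _ _ _ (is_derive_sum dh)) -big_split/=.
by apply: eq_bigr => i _; rewrite mulrDr.
Qed.

Lemma Ck_pdot k (U : set V) n q (f g : V -> 'rV[R]_n) : open U ->
  Ck k U f -> Ck k U g -> Ck k U (fun y => pdot q (f y) (g y)).
Proof.
move=> oU Cf Cg; apply: Ck_sum => // i.
apply: (@Ck_ext _ _ _ _ _ (cst ((-1) ^+ (i < q)%N) *
  ((fun y => f y ord0 i) * (fun y => g y ord0 i)))) => //.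
by do ![apply: Ck_mul => //]; [exact: Ck_cst|exact: Ck_coord|exact: Ck_coord].
Qed.

Lemma Ck_id k (U : set V) : Ck k U (@id V).
Proof. by apply: Ck_linear => // x; exact: cvg_id. Qed.

End Calculus.

Lemma Ck_mulmx m n k (U : set 'rV[R]_m) (B : 'M[R]_(m, n)) :
  open U -> Ck k U (fun y => y *m B).
Proof.
move=> oU.
have H : Ck k U (fun y : 'rV[R]_m => \sum_(i < m) y ord0 i *: row i B).
  apply: Ck_sum => // i; apply: Ck_scale => //; last exact: Ck_cst.
  by apply: Ck_coord => //; exact: Ck_id.
apply: Ck_ext oU _ H => y _.
by rewrite mulmx_sum_row.
Qed.

Lemma differentiable_mulmx m n (B : 'M[R]_(m, n)) (x : 'rV[R]_m) :
  differentiable (fun y => y *m B) x.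
Proof. by apply: (Ck_diff (@Ck_mulmx _ _ 0 setT B openT)). Qed.

Lemma derive_mulmx m n (B : 'M[R]_(m, n)) (x v : 'rV[R]_m) :
  'D_v (fun y => y *m B) x = v *m B.
Proof.
rewrite deriveE; last exact: differentiable_mulmx.
have cB : continuous (mulmxr B : {linear 'rV[R]_m -> 'rV[R]_n}).
  by move=> y; exact/differentiable_continuous/differentiable_mulmx.
by rewrite (diff_lin _ cB).
Qed.

End ScalarProduct.

(** * Isometries of the quadrics and their homogeneous extensions *)

Section FlatIsometry.
Local Open Scope classical_set_scope.
Local Open Scope ring_scope.
Context {R : realType}.
Variables (D Q : nat) (U : set 'rV[R]_D) (A : 'rV[R]_D -> 'rV[R]_D).
Hypotheses (oU : open U) (C2 : Ck 2 U A).
Hypothesis Aiso : forall y v w, U y ->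
  pdot Q ('D_v A y) ('D_w A y) = pdot Q v w.

Let dA y : U y -> differentiable A y. Proof. exact: (Ck_diff C2). Qed.

Let dDA y v : U y -> differentiable ('D_v A) y.
Proof. exact: (Ck_diff (Ck_derive v C2)). Qed.

(** The scalar symmetry [derive_comm], applied to each coordinate of [A]. *)
Let derive2_comm y v w : U y -> 'D_v ('D_w A) y = 'D_w ('D_v A) y.
Proof.
move=> Uy; apply/rowP => i.
have Hc u u' : 'D_u ('D_u' A) y ord0 i = 'D_u ('D_u' (fun z => A z ord0 i)) y.
  apply: etrans (esym (derive_coord u i (dDA u' Uy))) _.
  apply: near_eq_derive; apply: open_near_eq oU _ Uy => z Uz.
  exact: (esym (derive_coord u' i (dA Uz))).
apply: etrans (Hc _ _) (etrans _ (esym (Hc _ _))).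
exact: derive_comm oU (Ck_coord i oU C2) Uy.
Qed.

(* Only the symmetry of [D_v (D_w A)] is used: [D_v (D_v A)] is orthogonal to
   [D_w A] because [<D_v A, D_w A>] and [<D_v A, D_v A>] are constant, and the
   vectors [D_w A] span. *)
Lemma derive2_isometry y v : U y -> 'D_v ('D_v A) y = 0.
Proof.
move=> Uy.
have H u u' w : pdot Q ('D_w ('D_u A) y) ('D_u' A y) +
    pdot Q ('D_u A y) ('D_w ('D_u' A) y) = 0.
  apply: etrans (esym (derive_pdot Q w (dDA u Uy) (dDA u' Uy))) _.
  rewrite (@near_eq_derive _ _ _ _ (cst (pdot Q u u') : _ -> R)).
    by rewrite derive_cst.
  by apply: open_near_eq oU _ Uy => z; exact: Aiso.
apply: (@pdot_isometry_ortho _ D Q (jacobian A y)).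
  move=> u w; rewrite -(deriveEjacobian u (dA Uy)) -(deriveEjacobian w (dA Uy)).
  exact: Aiso.
move=> w; rewrite -(deriveEjacobian w (dA Uy)).
have Hvw := H v w v; have Hvv := H v v w.
have {}Hvv : pdot Q ('D_v A y) ('D_w ('D_v A) y) = 0.
  move: Hvv; rewrite pdotC -mulr2n => /eqP.
  by rewrite mulrn_eq0 /= => /eqP.
by rewrite (derive2_comm v w Uy) Hvv addr0 in Hvw.
Qed.

End FlatIsometry.

Section HomogeneousExtension.
Local Open Scope classical_set_scope.
Local Open Scope ring_scope.
Context {R : realType}.
Variables (eps : int) (D Q : nat).
Hypothesis heps : eps = 0 \/ eps = 1 \/ eps = -1.
Local Notation e := (eps%:~R : R).

(** Dimension and index are free parameters here; for each concrete [eps] the set of [space_form] is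
    an instance up to conversion. *)
Definition quadric : set 'rV[R]_D :=
  if eps == 0 then setT else [set x | pdot Q x x = e].

(* For [eps = 0] nothing is rescaled: the cone is the whole space, [normalize]
   is the identity and [homogeneous_ext F] is [F]. *)
Definition sqnorm (y : 'rV[R]_D) : R :=
  if eps == 0 then 1 else e * pdot Q y y.

Definition invnorm (y : 'rV[R]_D) : R := (Num.sqrt (sqnorm y))^-1.

Definition normalize (y : 'rV[R]_D) : 'rV[R]_D := invnorm y *: y.

Definition cone : set 'rV[R]_D := [set y | 0 < sqnorm y].

Lemma eps_sqr : eps != 0 -> e * e = 1.
Proof.
by case: heps => [->//|[->|->]] _; rewrite ?mulr1// mulrN1z mulrNN mulr1.
Qed.

Lemma sqnorm_quadric y : quadric y -> sqnorm y = 1.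
Proof.
rewrite /quadric /sqnorm; case: ifPn => // eps0 /= ->; exact: eps_sqr.
Qed.

Lemma invnorm_quadric y : quadric y -> invnorm y = 1.
Proof. by move=> Qy; rewrite /invnorm sqnorm_quadric// sqrtr1 invr1. Qed.

Lemma quadric_cone y : quadric y -> cone y.
Proof. by move=> Qy; rewrite /cone/= sqnorm_quadric. Qed.

Lemma sqnorm_invnorm y : cone y -> sqnorm y * (invnorm y * invnorm y) = 1.
Proof.
move=> y0; rewrite /invnorm -expr2 exprVn sqr_sqrtr ?ltW//.
by rewrite mulfV// gt_eqF.
Qed.

Lemma normalize_quadric y : cone y -> quadric (normalize y).
Proof.
move=> /sqnorm_invnorm; rewrite /quadric /sqnorm; case: ifPn => // eps0 H /=.
have e0 : e != 0.
  apply/eqP => e0; have /eqP := eps_sqr eps0.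
  by rewrite e0 mul0r eq_sym oner_eq0.
apply: (mulfI e0); rewrite eps_sqr// -[RHS]H /normalize pdotZl pdotZr.
by move: e (invnorm y) (pdot Q y y) => b c p; ring.
Qed.

Lemma Ck_sqnorm k (U : set 'rV[R]_D) : open U -> Ck k U sqnorm.
Proof.
move=> oU; rewrite /sqnorm; case: (eps == 0); first exact: Ck_cst.
apply: (@Ck_ext _ _ _ _ _ (cst e * (fun y => pdot Q y y))) => //.
apply: Ck_mul => //; first exact: Ck_cst.
by apply: Ck_pdot => //; exact: Ck_id.
Qed.

Lemma continuous_sqnorm : continuous sqnorm.
Proof.
move=> x; apply: differentiable_continuous.
by apply: (Ck_diff (@Ck_sqnorm 0 setT openT)).
Qed.

Lemma open_cone : open cone.
Proof.
rewrite (_ : cone = sqnorm @^-1` [set r | 0 < r])//.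
by apply: open_comp => [x _|]; [exact: continuous_sqnorm|exact: open_gt].
Qed.

Lemma Ck_invnorm k (U : set 'rV[R]_D) : open U -> U `<=` cone -> Ck k U invnorm.
Proof. by move=> oU UC; apply: Ck_invsqrt => //; exact: Ck_sqnorm. Qed.

Lemma Ck_normalize k (U : set 'rV[R]_D) : open U -> U `<=` cone -> Ck k U normalize.
Proof.
by move=> oU UC; apply: Ck_scale => //; [exact: Ck_invnorm|exact: Ck_id].
Qed.

Variables (O : set 'rV[R]_D) (F : 'rV[R]_D -> 'rV[R]_D).
Hypotheses (oO : open O) (sF : smooth_on O F).

(** The open cone on which the extension of degree one of [F] is smooth, [F] being controlled on [O]
    only. *)
Definition cone_over : set 'rV[R]_D := cone `&` normalize @^-1` O.

Lemma open_cone_over : open cone_over.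
Proof.
rewrite openE => y [Cy Oy]; apply: filterI; first exact: open_nbhs_nbhs (conj open_cone Cy).
have H : {for y, continuous normalize}.
  apply: differentiable_continuous.
  by apply: (Ck_diff (@Ck_normalize 0 cone open_cone _)).
by apply: H; exact: open_nbhs_nbhs.
Qed.

Lemma cone_over_cone : cone_over `<=` cone. Proof. by move=> y []. Qed.

(** On the cone this is the square root of [sqnorm y]; the product form makes its smoothness
    immediate. *)
Definition norm (y : 'rV[R]_D) : R := sqnorm y * invnorm y.

Definition homogeneous_ext (y : 'rV[R]_D) := norm y *: F (normalize y).

Lemma Ck_norm k : Ck k cone_over norm.
Proof.
have oU := open_cone_over; apply: (Ck_mul oU); first exact: Ck_sqnorm.
by apply: Ck_invnorm => //; exact: cone_over_cone.
Qed.

Lemma Ck_F_normalize k : Ck k cone_over (F \o normalize).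
Proof.
have oU := open_cone_over.
apply: (Ck_comp oU (U' := O)); first by move=> y [].
  by apply: Ck_normalize => //; exact: cone_over_cone.
by move/smooth_onP : sF; exact.
Qed.

Lemma Ck_homogeneous_ext k : Ck k cone_over homogeneous_ext.
Proof.
exact: Ck_scale open_cone_over (Ck_norm _) (Ck_F_normalize _).
Qed.

Variable mD : nat.
Let N := @Submfd R D mD Q quadric.

Lemma quadric_point y : quadric y -> exists z : N, \val z = y.
Proof.
by move=> Qy; exists (exist (fun x => x \in quadric) y (mem_set Qy) : N).
Qed.

Variable a : N -> N.
Hypothesis aiso : isometric a.
Hypothesis Fa : forall z : N, O (\val z) -> F (\val z) = \val (a z).

(** The radial projection of a straight line to the quadric: the family of curves on which the
    hypothesis [isometric a] is tested. The default [z0] is returned only off the quadric, which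
    does not happen for small [t] when [y] is in [cone_over]. *)
Definition ray (z0 : N) (y v : 'rV[R]_D) (t : R) : N :=
  insubd z0 (normalize (y + t *: v)).

Lemma cone_over_line y v : cone_over y ->
  open [set t : R^o | cone_over (y + t *: v)].
Proof.
move=> Uy.
rewrite (_ : mkset _ = (fun t : R^o => y + t *: v) @^-1` cone_over)//.
apply: open_comp => [t _|]; last exact: open_cone_over.
apply: cvgD; first exact: cvg_cst.
exact: scalel_continuous.
Qed.

Lemma val_ray z0 y v t : cone_over (y + t *: v) ->
  \val (ray z0 y v t) = normalize (y + t *: v).
Proof.
by move=> [Cy _]; rewrite val_insubd mem_set//; exact: normalize_quadric.
Qed.

Lemma Ck_line k (U : set R^o) (y v : 'rV[R]_D) : open U ->
  Ck k U (fun t : R^o => y + t *: v).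
Proof.
move=> oU; apply: (@Ck_add _ _ _ _ _ (cst y) (fun t : R^o => t *: v)) => //.
  exact: Ck_cst.
by apply: Ck_scale => //; [exact: Ck_id|exact: Ck_cst].
Qed.

Lemma smooth_ray z0 y v : cone_over y -> smooth_curve (ray z0 y v).
Proof.
move=> Uy; have oI := cone_over_line (v := v) Uy.
exists [set t : R^o | cone_over (y + t *: v)]; split => //.
  by rewrite /= scale0r addr0.
apply/smooth_onP => k.
apply: (@Ck_ext _ _ _ _ _ (normalize \o (fun t : R^o => y + t *: v))) => //.
  by move=> t Ut; rewrite val_ray.
apply: (Ck_comp oI (U' := cone_over)) => //; first exact: Ck_line.
by apply: Ck_normalize; [exact: open_cone_over|exact: cone_over_cone].
Qed.

Lemma near_line y v : cone_over y -> \forall t \near (0 : R), cone_over (y + t *: v).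
Proof.
move=> Uy; apply: (open_nbhs_nbhs (A := [set t : R^o | cone_over (y + t *: v)])).
by split; [exact: cone_over_line|rewrite /= scale0r addr0].
Qed.

Lemma velocity_line (W : normedModType R) (G : 'rV[R]_D -> W) (f : R -> W) y v :
  cone_over y -> differentiable G y ->
  (forall t, cone_over (y + t *: v) -> f t = G (y + t *: v)) ->
  derive1 f 0 = 'D_v G y.
Proof.
move=> Uy dG fG; rewrite derive1E.
rewrite (@near_eq_derive _ _ _ _ (fun t : R => G (y + t *: v))); last first.
  by near=> t; apply: fG; near: t; exact: near_line.
have := @is_derive_line _ _ _ G y v 0.
rewrite scale0r addr0 => /(_ (diff_derivable dG)) H.
by rewrite (@derive_val _ _ _ _ _ _ _ H).
Unshelve. all: by end_near. Qed.

Lemma velocity_ray z0 y v : cone_over y ->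
  velocity (ray z0 y v) = 'D_v normalize y.
Proof.
move=> Uy; apply: velocity_line => //; last by move=> t; exact: val_ray.
by apply: (Ck_diff (@Ck_normalize 0 _ open_cone_over cone_over_cone)).
Qed.

Lemma velocity_comp_ray z0 y v : cone_over y ->
  velocity (a \o ray z0 y v) = 'D_v (F \o normalize) y.
Proof.
move=> Uy; apply: velocity_line => //.
  by apply: (Ck_diff (Ck_F_normalize 0)).
move=> t Ut /=; rewrite -(val_ray z0 Ut) Fa// (val_ray z0 Ut).
by case: Ut.
Qed.

(** Both sides are products of velocities, of the curves [ray] on the right and of their images
    under [a] on the left. *)
Lemma pdot_derive_F_normalize y v w : cone_over y ->
  pdot Q ('D_v (F \o normalize) y) ('D_w (F \o normalize) y) =
  pdot Q ('D_v normalize y) ('D_w normalize y).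
Proof.
move=> Uy.
have [z0 _] := quadric_point (normalize_quadric (cone_over_cone Uy)).
rewrite -(velocity_comp_ray z0 v Uy) -(velocity_comp_ray z0 w Uy).
rewrite -(velocity_ray z0 v Uy) -(velocity_ray z0 w Uy).
apply: aiso; try exact: smooth_ray.
by apply: val_inj; rewrite !val_ray ?scale0r ?addr0.
Qed.

Lemma F_normalize_quadric y : cone_over y -> quadric (F (normalize y)).
Proof.
move=> [Cy Oy]; have [z zE] := quadric_point (normalize_quadric Cy).
by rewrite -zE Fa ?zE//; exact: set_valP.
Qed.

Lemma norm_normalize y : cone_over y -> norm y *: normalize y = y.
Proof.
case=> Cy _; rewrite /norm /normalize scalerA -mulrA sqnorm_invnorm//.
by rewrite scale1r.
Qed.

(** The function [pdot Q (G y) (G y)] is constant on [cone_over], and its derivative is twice the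
    product in question. *)
Lemma pdot_derive_quadric (G : 'rV[R]_D -> 'rV[R]_D) y v : eps != 0 ->
  (forall y, cone_over y -> quadric (G y)) -> differentiable G y ->
  cone_over y -> pdot Q (G y) ('D_v G y) = 0.
Proof.
move=> eps0 QG dG Uy.
have : 'D_v (fun y => pdot Q (G y) (G y)) y = 0.
  rewrite (@near_eq_derive _ _ _ _ (cst e : _ -> R)) ?derive_cst//.
  apply: open_near_eq open_cone_over _ Uy => z /QG.
  by rewrite /quadric (negPf eps0).
rewrite derive_pdot// pdotC -mulr2n => /eqP.
by rewrite mulrn_eq0 /= => /eqP.
Qed.

(** The product rule splits ['D_v homogeneous_ext y] into a radial part along [F (normalize y)] and
    a tangential part; the vector [v] splits with the same coefficients, by differentiating
    [norm_normalize]. Tangential products agree since [a] is isometric. For [eps != 0] the radial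
    vectors have equal squares and are orthogonal to the tangential ones; for [eps = 0] the norm is
    constant and the radial parts vanish. *)
Lemma pdot_derive_homogeneous_ext y v w : cone_over y ->
  pdot Q ('D_v homogeneous_ext y) ('D_w homogeneous_ext y) = pdot Q v w.
Proof.
move=> Uy.
have dn : differentiable norm y by exact: (Ck_diff (Ck_norm 0)).
have dF : differentiable (F \o normalize) y by exact: (Ck_diff (Ck_F_normalize 0)).
have dP : differentiable normalize y.
  by apply: (Ck_diff (@Ck_normalize 0 _ open_cone_over cone_over_cone)).
have DA u : 'D_u homogeneous_ext y =
    'D_u norm y *: F (normalize y) + norm y *: 'D_u (F \o normalize) y.
  exact: derive_scale dn dF.
have Did u : u = 'D_u norm y *: normalize y + norm y *: 'D_u normalize y.
  rewrite -derive_scale// (@near_eq_derive _ _ _ _ id) ?derive_id//.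
  by apply: open_near_eq open_cone_over _ Uy => z; exact: norm_normalize.
rewrite (DA v) (DA w) [in RHS](Did v) [in RHS](Did w).
apply: (pdot_polar _ (pdot_derive_F_normalize v w Uy)).
have [eps0|eps0] := eqVneq eps 0; [left|right].
  suff D0 u : 'D_u norm y = 0 by split; exact: D0.
  rewrite (_ : norm = cst 1) ?derive_cst//; apply/funext => z.
  by rewrite /norm /invnorm /sqnorm eps0 eqxx sqrtr1 invr1 mulr1.
have QP z : cone_over z -> quadric (normalize z).
  by case=> Cz _; exact: normalize_quadric.
have HF u := pdot_derive_quadric u eps0 F_normalize_quadric dF Uy.
have HP u := pdot_derive_quadric u eps0 QP dP Uy.
split; [|exact: HF|exact: HF|exact: HP|exact: HP].
have := F_normalize_quadric Uy; have := QP _ Uy.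
by rewrite /quadric (negPf eps0) /= => -> ->.
Qed.

Lemma derive2_homogeneous_ext y v : cone_over y ->
  'D_v ('D_v homogeneous_ext) y = 0.
Proof.
move=> Uy; apply: (derive2_isometry open_cone_over (Ck_homogeneous_ext 2) _ v Uy).
by move=> z u w Uz; exact: pdot_derive_homogeneous_ext.
Qed.

End HomogeneousExtension.

(** * The immersions [f_c], and why [f_1] and [f_0] are not congruent *)

Section LiftedEmbedding.
Local Open Scope classical_set_scope.
Local Open Scope ring_scope.
Context {R : realType}.
Variables (eps : int) (d md q D mD Q : nat).
Hypothesis heps : eps = 0 \/ eps = 1 \/ eps = -1.
Variables (E : 'M[R]_(d, D)) (xi eta : 'rV[R]_D) (l : 'I_d).
Hypothesis pdotE : forall x y, pdot Q (x *m E) (y *m E) = pdot q x y.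
Hypothesis xiE : forall x, pdot Q xi (x *m E) = 0.
Hypothesis etaE : forall x, pdot Q eta (x *m E) = 0.
Hypothesis xi_null : pdot Q xi xi = 0.
Hypothesis eta_xi : pdot Q eta xi = 2.

Local Notation M := (@Submfd R d md q (quadric eps q)).
Local Notation N := (@Submfd R D mD Q (quadric eps Q)).

(** This is [f_c], with [E] the matrix of [J]. Pairing with [eta], which is orthogonal to the image
    of [E], reads off twice the coefficient of [xi]. *)
Definition lift (c : R) (x : 'rV[R]_d) : 'rV[R]_D :=
  x *m E + (c * (x ord0 l * x ord0 l)) *: xi.

(** Components along [xi] are invisible to the scalar product. Hence [lift] maps quadric to quadric,
    and its differential preserves the metric. *)
Lemma pdot_lift (a b : R) x y :
  pdot Q (x *m E + a *: xi) (y *m E + b *: xi) = pdot q x y.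
Proof.
rewrite !(pdotDl, pdotDr, pdotZl, pdotZr) xi_null pdotE !xiE [pdot Q (x *m E) xi]pdotC xiE.
by rewrite !(mulr0, addr0).
Qed.

Lemma quadric_lift c x : quadric eps q x -> quadric eps Q (lift c x).
Proof.
by rewrite /quadric; case: (eps == 0) => //= <-; rewrite pdot_lift.
Qed.

Definition lift_map (c : R) (x : M) : N :=
  exist (fun y => y \in quadric eps Q) (lift c (\val x))
    (mem_set (quadric_lift c (set_valP x))).

(** The parameter varies together with the point: this joint smoothness is what gives the
    convergence of [f_c] to [f_0]. *)
Lemma Ck_lift (V : normedModType R) k (U : set V) (c : V -> R) (f : V -> 'rV[R]_d) : open U ->
  Ck k U c -> Ck k U f -> Ck k U (fun y => lift (c y) (f y)).
Proof.
move=> oU Cc Cf.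
have Cfl := Ck_coord l oU Cf.
apply: (Ck_add oU (f := fun y => f y *m E)).
  exact: (Ck_comp oU (U' := setT) _ Cf (Ck_mulmx _ _ openT)).
exact: Ck_scale oU (Ck_mul oU Cc (Ck_mul oU Cfl Cfl)) (Ck_cst _ _ _).
Qed.

Lemma smooth_lift_map c : smooth_map (lift_map c).
Proof.
move=> x; exists setT, (lift c); split => //; first exact: openT.
apply/smooth_onP => k.
by apply: (@Ck_lift _ k setT (cst c) id openT); [exact: Ck_cst|exact: Ck_id].
Qed.

(** The coefficient [b] is left unspecified, since [pdot_lift] holds for all coefficients of
    [xi]. *)
Lemma velocity_lift_map c (g : R -> M) : smooth_curve g ->
  exists b, velocity (lift_map c \o g) = velocity g *m E + b *: xi.
Proof.
move=> [I [oI I0 sI]]; pose f (t : R) : 'rV[R]_d := \val (g t).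
have df : differentiable f 0 by exact: (sI [::]).
have dfl := differentiable_coordf l df.
pose h : R -> R := cst c * ((fun t => f t ord0 l) * (fun t => f t ord0 l)).
have dh : differentiable h 0.
  apply: differentiableM; first exact: differentiable_cst.
  exact: differentiableM.
have dE y : differentiable (fun y : 'rV[R]_d => y *m E) y.
  exact: differentiable_mulmx.
have dfE := differentiable_comp df (dE (f 0)).
have dhx : differentiable (fun t => h t *: xi) 0 by exact: differentiableZl.
exists ('D_1 h 0); rewrite /velocity !derive1E.
rewrite (_ : (fun t => _) = ((fun y => y *m E) \o f) + (fun t => h t *: xi))//.
rewrite (deriveD (diff_derivable dfE) (diff_derivable dhx)).
rewrite (derive_comp _ df (dE _)) derive_mulmx.
congr (_ + _).
have := @derive_scale R _ D h (cst xi) 0 1 dh (differentiable_cst xi _).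
by rewrite derive_cst scaler0 addr0.
Qed.

Lemma isometric_lift_map c : isometric (lift_map c).
Proof.
move=> g h sg sh gh.
have [a ->] := velocity_lift_map c sg; have [b ->] := velocity_lift_map c sh.
exact: pdot_lift.
Qed.

Variable x0 : 'rV[R]_d.
Hypothesis quadric_x0 : quadric eps q x0.
Hypothesis x0l : x0 ord0 l = 0.

(** The function [pdot Q eta (A (y *m E))] is differentiated twice along the [l]-th basis vector at
    [x0]. The result is 0 because second derivatives of [A] vanish, and 4 because the congruence
    makes the function equal to [2 c^2 k], with [c] the [l]-th coordinate and [k] the inverse
    norm. *)
Lemma lift_map_not_congruent (a : N -> N) : Defs.isometry a ->
  lift_map 1 = a \o lift_map 0 -> False.
Proof.
move=> [sa aiso _] aE.
have [z0 z0E] := quadric_point md quadric_x0.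
have val_lift0 z : \val (lift_map 0 z) = \val z *m E.
  by rewrite /= /lift mul0r scale0r addr0.
have [B [F [oO OX sF FaE]]] := sa (lift_map 0 z0).
rewrite val_lift0 z0E in OX.
have QX : quadric eps Q (x0 *m E).
  by move: quadric_x0; rewrite /quadric; case: (eps == 0) => //= <-.
pose U := cone_over eps Q B; pose A := homogeneous_ext eps Q F.
have oU : open U by exact: open_cone_over.
have UX : U (x0 *m E).
  split; first exact: (quadric_cone heps QX).
  by rewrite /= /normalize (invnorm_quadric heps QX) scale1r.
have C2 : Ck 2 U A by exact: Ck_homogeneous_ext.
have DA := @derive2_homogeneous_ext R eps D Q heps B F oO sF mD a aiso FaE.
pose e : 'rV[R]_d := delta_mx ord0 l.
pose W := [set y : 'rV[R]_d | U (y *m E)].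
have oW : open W.
  rewrite (_ : W = (fun y => y *m E) @^-1` U)//; apply: open_comp => // y _.
  exact/differentiable_continuous/differentiable_mulmx.
pose k (y : 'rV[R]_d) : R := invnorm eps Q (y *m E).
pose c (y : 'rV[R]_d) : R := y ord0 l.
(* Rescaling [y] to [y'] puts it on the quadric, where [a] carries [lift 0 y'] to [lift 1 y']; the
   factor [norm] of the extension then cancels one power of [k] against [sqnorm]. *)
have hE y : W y -> pdot Q eta (A (y *m E)) = (cst 2 * (c * c * k)) y.
  move=> [Cy Oy].
  pose y' := k y *: y.
  have y'E : normalize eps Q (y *m E) = y' *m E by rewrite /y' -scalemxAl.
  have Qy' : quadric eps q y'.
    have := normalize_quadric heps Cy; rewrite y'E /quadric.
    by case: (eps == 0) => //=; rewrite pdotE.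
  have [z zE] := quadric_point md Qy'.
  have zE0 : normalize eps Q (y *m E) = \val (lift_map 0 z).
    by rewrite val_lift0 zE.
  have -> : A (y *m E) = norm eps Q (y *m E) *: lift 1 y'.
    rewrite /A /homogeneous_ext zE0 FaE -?zE0//.
    by rewrite -zE -[lift 1 _]/(\val (lift_map 1 z)) aE.
  rewrite pdotZr pdotDr etaE pdotZr eta_xi add0r mul1r !mxE /norm.
  have := sqnorm_invnorm Cy; rewrite -/(k y) !fctE -/(c y).
  move: (sqnorm _ _ _) (k y) (c y) => s g r sg.
  transitivity ((s * (g * g)) * (2 * (r * r * g))); first by ring.
  by rewrite sg mul1r.
have WX : W x0 by [].
have dE y : differentiable (fun y : 'rV[R]_d => y *m E) y.
  exact: differentiable_mulmx.
have D1 (G : 'rV[R]_D -> 'rV[R]_D) y : W y -> differentiable G (y *m E) ->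
    'D_e (fun y => pdot Q eta (G (y *m E))) y = pdot Q eta ('D_(e *m E) G (y *m E)).
  move=> Wy dG.
  have dGE := differentiable_comp (dE y) dG.
  have := derive_pdot Q e (differentiable_cst (W' := 'rV[R]_D) eta y) dGE.
  rewrite derive_cst pdot0l add0r => /= H.
  by apply: etrans H _; rewrite (derive_comp _ (dE y) dG) derive_mulmx.
have D2 : 'D_e ('D_e (cst 2 * (c * c * k) : _ -> R)) x0 = 0.
  have H1 : 'D_e ('D_e (fun y => pdot Q eta (A (y *m E)))) x0 = 0.
    rewrite (@near_eq_derive _ _ _ _
        (fun y => pdot Q eta ('D_(e *m E) A (y *m E)))); last first.
      apply: (open_near_eq oW _ WX) => y Wy; apply: D1 => //.
      exact: (Ck_diff C2).
    have dDA := Ck_diff (Ck_derive (e *m E) C2) UX.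
    by apply: etrans (D1 ('D_(e *m E) A) _ WX dDA) _; rewrite DA// pdot0r.
  rewrite -H1; apply: near_eq_derive; apply: (open_near_eq oW _ WX) => y Wy.
  by apply: near_eq_derive; apply: (open_near_eq oW _ Wy) => z /hE ->.
have Ckk j : Ck j W k.
  apply: (@Ck_invsqrt _ _ _ _ (sqnorm eps Q \o (fun y => y *m E))) => //.
    by move=> y [].
  move=> {D1 D2}; rewrite /sqnorm; case: (eps == 0) => /=; first exact: Ck_cst.
  apply: (Ck_mul oW (f := cst _)); first exact: Ck_cst.
  by apply: Ck_pdot => //; exact: Ck_mulmx.
have Dc y : is_derive y e c 1.
  have dc : differentiable c y by exact: differentiable_coord.
  apply: DeriveDef; first exact: diff_derivable.
  have di : differentiable (@id 'rV[R]_d) y by apply: (Ck_diff (@Ck_id R _ 0 setT)).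
  by rewrite (derive_coord e l di) ?derive_id ?mxE ?eqxx.
have Dk y : W y -> is_derive y e k ('D_e k y).
  by move=> Wy; apply/derivableP/diff_derivable; exact: (Ck_diff (Ckk 0%N)).
have DDk : is_derive x0 e ('D_e k) ('D_e ('D_e k) x0).
  by apply/derivableP/diff_derivable; exact: (Ck_diff (Ck_derive e (Ckk 1%N))).
(* Since [c] vanishes and [k] equals 1 at [x0], only the terms with both derivatives on the two
   factors [c] survive, giving [2 * (1 + 1)]. *)
move: D2.
rewrite (@near_eq_derive _ _ _ _ (cst 2 * (c * c * 'D_e k + k * (c + c)) : _ -> R)); last first.
  apply: (open_near_eq oW _ WX) => y Wy.
  have H := is_deriveM (is_derive_cst (2 : R) y e) (is_deriveM (is_deriveM (Dc y) (Dc y)) (Dk y Wy)).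
  rewrite (@derive_val _ _ _ _ _ _ _ H) /GRing.scale/= !fctE.
  by rewrite mulr0 addr0 !mulr1.
have H := is_deriveM (is_derive_cst (2 : R) x0 e) (is_deriveD
  (is_deriveM (is_deriveM (Dc x0) (Dc x0)) DDk)
  (is_deriveM (Dk _ WX) (is_deriveD (Dc x0) (Dc x0)))).
rewrite (@derive_val _ _ _ _ _ _ _ H) /GRing.scale/= !fctE.
have -> : c x0 = 0 by [].
have -> : k x0 = 1 by rewrite /k (invnorm_quadric heps QX).
rewrite !(mul0r, mulr0, add0r, addr0, mul1r) => /eqP.
by rewrite mulf_eq0 !pnatr_eq0.
Qed.

End LiftedEmbedding.

(** * Composition of smooth maps, isometries and their orbits *)

Section IsometryGroup.
Local Open Scope classical_set_scope.
Local Open Scope ring_scope.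
Context {R : realType}.
Implicit Types M N P : submfd R.

Lemma smooth_continuous (V W : normedModType R) (U : set V) (f : V -> W) x :
  smooth_on U f -> U x -> {for x, continuous f}.
Proof. by move=> /(_ [::] x) h Ux; apply: differentiable_continuous; exact: h. Qed.

Lemma open_preimage_smooth (V W : normedModType R) (U : set V) (B : set W)
    (f : V -> W) : open U -> smooth_on U f -> open B -> open (U `&` f @^-1` B).
Proof.
move=> oU sf oB; rewrite openE => x [Ux Bx]; apply: filterI.
  exact: open_nbhs_nbhs.
by apply: (smooth_continuous sf Ux); exact: open_nbhs_nbhs.
Qed.

Lemma smooth_comp (V : normedModType R) n m (U : set V) (B : set 'rV[R]_n)
    (f : V -> 'rV[R]_n) (g : 'rV[R]_n -> 'rV[R]_m) : open U ->
  smooth_on U f -> smooth_on B g -> open B ->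
  smooth_on (U `&` f @^-1` B) (g \o f).
Proof.
move=> oU sf sg oB; apply/smooth_onP => k.
have oUB := open_preimage_smooth oU sf oB.
apply: (Ck_comp oUB (U' := B)); first by move=> x [].
  by apply: (Ck_sub (U := U)) => [x []//|]; move/smooth_onP : sf; exact.
by move/smooth_onP : sg; exact.
Qed.

Lemma smooth_ext (V W : normedModType R) (U : set V) (f g : V -> W) :
  open U -> (forall y, U y -> f y = g y) -> smooth_on U f -> smooth_on U g.
Proof.
move=> oU fg /smooth_onP sf; apply/smooth_onP => k; exact: Ck_ext oU fg (sf k).
Qed.

Lemma smooth_map_comp M N P (f : M -> N) (g : N -> P) :
  smooth_map f -> smooth_map g -> smooth_map (g \o f).
Proof.
move=> sf sg x.
have [B [F [oB Bx sF FE]]] := sf x.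
have [C [G [oC Cx sG GE]]] := sg (f x).
exists (B `&` F @^-1` C), (G \o F); split.
- exact: open_preimage_smooth.
- by split; rewrite //= FE.
- exact: smooth_comp.
- by move=> y [By]; rewrite /= FE// => Cy; rewrite GE.
Qed.

Lemma smooth_curve_comp M N (f : M -> N) (g : R -> M) :
  smooth_map f -> smooth_curve g -> smooth_curve (f \o g).
Proof.
move=> sf [I [oI I0 sI]].
have [B [F [oB Bx sF FE]]] := sf (g 0).
have oIB := open_preimage_smooth oI sI oB.
exists (I `&` (fun t : R^o => \val (g t)) @^-1` B); split => //.
apply: (@smooth_ext _ _ _ (F \o (fun t : R^o => \val (g t)))) => //.
  by move=> t [_ Bt] /=; rewrite FE.
exact: smooth_comp.
Qed.

Lemma isometry_comp M (a b : M -> M) :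
  Defs.isometry a -> Defs.isometry b -> Defs.isometry (a \o b).
Proof.
move=> [sa ia [a' [sa' aK a'K]]] [sb ib [b' [sb' bK b'K]]]; split.
- exact: smooth_map_comp.
- move=> g h sg sh gh; rewrite -(ib g h sg sh gh).
  have := ia (b \o g) (b \o h) (smooth_curve_comp sb sg) (smooth_curve_comp sb sh).
  by rewrite /= gh => /(_ erefl).
- exists (b' \o a'); split; first exact: smooth_map_comp.
    exact: can_comp.
  exact: can_comp.
Qed.

Lemma isometry_id M : Defs.isometry (@id M).
Proof.
have si : smooth_map (@id M).
  move=> x; exists setT, id; split => //; first exact: openT.
  by apply/smooth_onP => k; exact: Ck_id.
by split => //; exists id; split.
Qed.

(** Congruences in both directions are supplied, which avoids proving that the inverse of an
    isometry is isometric. *)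
Lemma orbit_of_isometry M N (f g : isometric_immersions M N) (a b : N -> N) :
  Defs.isometry a -> Defs.isometry b ->
  imm_fun g = a \o imm_fun f -> imm_fun f = b \o imm_fun g ->
  orbit_of f = orbit_of g.
Proof.
move=> ia ib gf fg; apply/seteqP; split => h [c ic hc].
  by exists (c \o b); [exact: isometry_comp|rewrite hc fg].
by exists (c \o a); [exact: isometry_comp|rewrite hc gf].
Qed.

Lemma eq_orbit_pi M N (f g : isometric_immersions M N) :
  orbit_of f = orbit_of g -> orbit_pi f = orbit_pi g.
Proof. by move=> fg; apply: eq_sig_hprop => // ?; exact: Prop_irrelevance. Qed.

(** This is the definition of the quotient topology, once the locked canonical projection is
    unfolded to [orbit_pi]. *)
Lemma open_preimage_orbit_pi M N (A : set (moduli_space M N)) :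
  open A -> open (@orbit_pi R M N @^-1` A).
Proof.
move=> oA; have : @quotient_open _
  (orbit_space M N : quotType (isometric_immersions M N)) A := oA.
by rewrite /quotient_open generic_quotient.pi.unlock.
Qed.

End IsometryGroup.

(** * Boosts of the plane spanned by the null vectors [xi] and [eta] *)

Section Boost.
Local Open Scope classical_set_scope.
Local Open Scope ring_scope.
Context {R : realType}.
Variables (eps : int) (D mD Q : nat) (xi eta : 'rV[R]_D).
Hypothesis xi_null : pdot Q xi xi = 0.
Hypothesis eta_null : pdot Q eta eta = 0.
Hypothesis eta_xi : pdot Q eta xi = 2.
Local Notation N := (@Submfd R D mD Q (quadric eps Q)).

(** The linear map with [xi] sent to [c xi] and [eta] to [c^-1 eta], and the identity on vectors
    orthogonal to both. As [pdot Q eta xi = 2], halving the products with [eta] and [xi] gives the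
    coefficients along [xi] and [eta]. *)
Definition boost (c : R) (x : 'rV[R]_D) : 'rV[R]_D :=
  x + ((c - 1) / 2 * pdot Q eta x) *: xi + ((c^-1 - 1) / 2 * pdot Q xi x) *: eta.

Lemma boost_linear c : linear (boost c).
Proof.
move=> b x y; apply/rowP => i; rewrite /boost !(pdotDr, pdotZr) !mxE.
by ring.
Qed.

Let xi_eta : pdot Q xi eta = 2. Proof. by rewrite pdotC. Qed.

Lemma pdot_boost c x y : c != 0 -> pdot Q (boost c x) (boost c y) = pdot Q x y.
Proof.
move=> c0; rewrite /boost !(pdotDl, pdotDr, pdotZl, pdotZr).
rewrite xi_null eta_null eta_xi xi_eta [pdot Q x xi]pdotC [pdot Q x eta]pdotC.
by field.
Qed.

Lemma boostK c : c != 0 -> cancel (boost c) (boost c^-1).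
Proof.
move=> c0 x; rewrite {1}/boost.
have -> : pdot Q eta (boost c x) = c * pdot Q eta x.
  by rewrite /boost !(pdotDr, pdotZr) eta_xi eta_null; field.
have -> : pdot Q xi (boost c x) = c^-1 * pdot Q xi x.
  by rewrite /boost !(pdotDr, pdotZr) xi_eta xi_null; field.
by apply/rowP => i; rewrite invrK /boost !mxE; field.
Qed.

Definition boost_mx (c : R) : 'M[R]_D := lin1_mx (boost c).

Lemma mul_boost_mx c x : x *m boost_mx c = boost c x.
Proof.
pose bM := GRing.isLinear.Build _ _ _ _ _ (@boost_linear c).
pose bL : {linear 'rV[R]_D -> 'rV[R]_D} := HB.pack (boost c) bM.
exact: (mul_rV_lin1 bL).
Qed.

Lemma quadric_boost c x : c != 0 -> quadric eps Q x -> quadric eps Q (boost c x).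
Proof.
by move=> c0; rewrite /quadric; case: (eps == 0) => //= <-; rewrite pdot_boost.
Qed.

Definition boost_map (c : R) (c0 : c != 0) (x : N) : N :=
  exist (fun y => y \in quadric eps Q) (boost c (\val x))
    (mem_set (quadric_boost c0 (set_valP x))).

Lemma smooth_boost_map c (c0 : c != 0) : smooth_map (boost_map c0).
Proof.
move=> x; exists setT, (fun y => y *m boost_mx c); split => //.
- exact: openT.
- by apply/smooth_onP => k; apply: Ck_mulmx; exact: openT.
- by move=> y _; rewrite mul_boost_mx.
Qed.

Lemma isometric_boost_map c (c0 : c != 0) : isometric (boost_map c0).
Proof.
have vb g : smooth_curve g -> velocity (boost_map c0 \o g) = boost c (velocity g).
  move=> [I [oI I0 sI]].
  have dg : differentiable (fun t : R => \val (g t) : 'rV[R]_D) 0 by exact: (sI [::]).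
  have H := @derive_comp R _ _ _ (fun t : R => \val (g t) : 'rV[R]_D)
    (fun y => y *m boost_mx c) 0 1 dg (differentiable_mulmx _ _).
  rewrite derive_mulmx in H.
  rewrite /velocity !derive1E -mul_boost_mx -H.
  by rewrite (_ : (fun t => _) = (fun y => y *m boost_mx c) \o (fun t => \val (g t)))//;
    apply/funext => t /=; rewrite mul_boost_mx.
by move=> g h sg sh _; rewrite (vb g sg) (vb h sh) (pdot_boost _ _ c0).
Qed.

Lemma isometry_boost_map c (c0 : c != 0) : Defs.isometry (boost_map c0).
Proof.
have ci0 : c^-1 != 0 by rewrite invr_neq0.
split; [exact: smooth_boost_map|exact: isometric_boost_map|].
exists (boost_map ci0); split; first exact: smooth_boost_map.
  by move=> x; apply: val_inj; exact: (boostK c0).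
by move=> x; apply: val_inj => /=; have := boostK ci0 (\val x); rewrite invrK.
Qed.

End Boost.

(** * Convergence of smooth families in the compact-open topology *)

Section SmoothFamily.
Local Open Scope classical_set_scope.
Local Open Scope ring_scope.
Context {R : realType}.

(** Directions with zero last component leave the parameter fixed. The derivatives of all members of
    a family thus become derivatives of one function on the product, continuous in point and
    parameter together. *)
Lemma iter_derive_slice (V W : normedModType R) (P : V * R -> W) (vs : seq V)
    (b : R) (x : V) :
  iter_derive [seq (v, 0 : R) | v <- vs] P (x, b) =
  iter_derive vs (fun y => P (y, b)) x.
Proof.
elim: vs x => [//|v vs IH] x /=.
have shiftE (t : R) : t *: (v, 0) + (x, b) = (t *: v + x, b).
  by congr pair; rewrite /= scaler0 add0r.
rewrite /derive -IH; congr (lim _).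
rewrite (_ : (fun t : R => _) = (fun t : R => t^-1 *:
    ((iter_derive vs (fun y => P (y, b)) \o shift x) (t *: v) -
     iter_derive [seq (v, 0 : R) | v <- vs] P (x, b))))//.
by apply/funext => t /=; rewrite -IH -shiftE.
Qed.

(** There are finitely many words of length at most [r] over [T]; the induction splits off the first
    letter. *)
Lemma seq_bounded_near (T : finType) (I : Type) (F : set_system I) (r : nat)
    (P : I -> seq T -> Prop) : Filter F ->
  (forall s, (size s <= r)%N -> \forall i \near F, P i s) ->
  \forall i \near F, forall s, (size s <= r)%N -> P i s.
Proof.
move=> FF; elim: r P => [|r IH] P FP.
  by apply: filterS (FP [::] isT) => i Pi [].
have FP1 x : \forall i \near F, forall s, (size s <= r)%N -> P i (x :: s).
  by apply: (IH (fun i s => P i (x :: s))) => s; exact: (FP (x :: s)).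
have {}FP1 := filter_forall FF FP1.
by apply: filterS2 (FP [::] isT) FP1 => i Pi0 Pi1 [|x s]//= sr; exact: Pi1.
Qed.

Variables (M N : submfd R).

Lemma smooth_in_charts (f : M -> N) (c : chart M) (c' : chart N) w :
  smooth_map f -> chart_img c w ->
  chart_nbhd c' (\val (f (chart_param c w))) ->
  exists U, [/\ open U, U w & smooth_on U (in_charts c c' f)].
Proof.
move=> sf cw cfw.
have [B [F [oB Bx sF FE]]] := sf (chart_param c w).
pose p w := \val (chart_param c w).
have sp : smooth_on (chart_img c) p by exact: chart_param_smooth.
have oU1 := open_preimage_smooth (@chart_img_open _ _ c) sp oB.
have sFp := smooth_comp (@chart_img_open _ _ c) sp sF oB.
have oU2 := open_preimage_smooth oU1 sFp (@chart_nbhd_open _ _ c').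
exists ((chart_img c `&` p @^-1` B) `&` (F \o p) @^-1` chart_nbhd c'); split => //.
  by split; [split|rewrite /= /p FE].
apply: (@smooth_ext _ _ _ _ (chart_coord c' \o (F \o p))) => //.
  by move=> y [[_ By] _] /=; rewrite /p FE.
exact: smooth_comp oU1 sFp (@chart_coord_smooth _ _ c') (@chart_nbhd_open _ _ c').
Qed.

Variable h : R -> Cinfty M N.
Variable H : R -> 'rV[R]_(sub_amb M) -> 'rV[R]_(sub_amb N).
Hypothesis HE : forall b (x : M), H b (\val x) = \val (sval (h b) x).
Hypothesis CkH : forall (V : normedModType R) k (U : set V) (b : V -> R)
    (f : V -> 'rV[R]_(sub_amb M)),
  open U -> Ck k U b -> Ck k U f -> Ck k U (fun y => H (b y) (f y)).

(** In charts the family is a single smooth function [Psi] of [(w, b)]. Both conditions persist near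
    each [(w, b0)] by continuity, and compactness of [K] makes the neighbourhood of [b0] uniform in
    [w]. The centre [f] may differ from [h b0], so its derivatives need a continuity argument of
    their own. *)
Lemma near_subbasic f (c : chart M) (c' : chart N) K r e b0 :
  compact K -> K `<=` chart_img c ->
  (forall w, K w -> chart_nbhd c' (\val (sval f (chart_param c w)))) ->
  Cinfty_subbasic f c c' K r e (h b0) ->
  \forall b \near b0, Cinfty_subbasic f c c' K r e (h b).
Proof.
move=> cK Kc fK [h0K h0e].
pose V := ('rV[R]_(sub_dim M) * R)%type.
pose p (z : V) := \val (chart_param c z.1).
pose U1 : set V := fst @^-1` chart_img c.
have cfst : continuous (@fst 'rV[R]_(sub_dim M) R) by move=> ?; exact: cvg_fst.
have csnd : continuous (@snd 'rV[R]_(sub_dim M) R) by move=> ?; exact: cvg_snd.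
have oU1 : open U1 by apply: open_comp (@chart_img_open _ _ c) => ? _; exact: cfst.
have Cp k : Ck k U1 p.
  apply: (Ck_comp oU1 (U' := chart_img c)
      (f := fst) (g := fun w => \val (chart_param c w))) => //.
    by apply: Ck_linear => //.
  by have /smooth_onP := @chart_param_smooth _ _ c; apply.
have sHp : smooth_on U1 (fun z : V => H z.2 (p z)).
  apply/smooth_onP => k; apply: CkH => //.
  by apply: (@Ck_linear _ _ _ _ _ snd).
have oU2 := open_preimage_smooth oU1 sHp (@chart_nbhd_open _ _ c').
have sPsi := smooth_comp oU1 sHp (@chart_coord_smooth _ _ c') (@chart_nbhd_open _ _ c').
set U2 := _ `&` _ in oU2 sPsi; set Psi := _ \o _ in sPsi.
have KU2 w : K w -> U2 (w, b0).
  by move=> Kw; split; [exact: Kc|rewrite /= HE; exact: h0K].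
have PsiE b : in_charts c c' (sval (h b)) = fun w => Psi (w, b).
  by apply/funext => w; rewrite /Psi /= HE.
have near1 : \forall b \near b0, K `<=`
    (fun w => chart_nbhd c' (\val (sval (h b) (chart_param c w)))).
  (* Compactness as near-covering: it suffices to find, for each [w] in [K], a neighbourhood of
     [(w, b0)]. *)
  apply: (iffLR (compact_near_coveringP K) cK R (nbhs b0) (fun b w =>
    chart_nbhd c' (\val (sval (h b) (chart_param c w))))) => w /KU2 Kw.
  have : nbhs (w, b0) U2 by exact: open_nbhs_nbhs.
  by apply: filterS => -[w' b] [_ /=]; rewrite HE.
have near2 : \forall b \near b0, forall I, (size I <= r)%N -> K `<=`
    (fun w => `|partial I (in_charts c c' (sval (h b))) w
              - partial I (in_charts c c' (sval f)) w| < e).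
  apply: (@seq_bounded_near _ R (nbhs b0) r (fun b I => K `<=`
    (fun w => `|partial I (in_charts c c' (sval (h b))) w
              - partial I (in_charts c c' (sval f)) w| < e))) => I Ir.
  apply: (iffLR (compact_near_coveringP K) cK R (nbhs b0) (fun b w =>
    `|partial I (in_charts c c' (sval (h b))) w
      - partial I (in_charts c c' (sval f)) w| < e)) => w Kw.
  pose vs := [seq (delta_mx ord0 i : 'rV[R]_(sub_dim M)) | i <- I].
  have cPsi : {for (w, b0), continuous
      (iter_derive [seq (v, 0 : R) | v <- vs] Psi : V -> _)}.
    by apply: differentiable_continuous; apply: sPsi; exact: KU2.
  have [U [oU Uw sU]] := smooth_in_charts (svalP f) (Kc _ Kw) (fK _ Kw).
  have cf : {for (w, b0), continuous
      (iter_derive vs (in_charts c c' (sval f)) \o fst : V -> _)}.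
    apply: continuous_comp; first exact: cfst.
    by apply: differentiable_continuous; exact: sU.
  have cD := continuousB cPsi cf.
  have cn := continuous_comp cD (@norm_continuous _ _ _).
  have lt0 : `|iter_derive [seq (v, 0 : R) | v <- vs] Psi (w, b0)
      - iter_derive vs (in_charts c c' (sval f)) w| < e.
    by have := h0e I w Ir Kw; rewrite PsiE /partial -iter_derive_slice.
  have : nbhs (w, b0) [set z : V | `|iter_derive [seq (v, 0 : R) | v <- vs] Psi z
      - iter_derive vs (in_charts c c' (sval f)) z.1| < e].
    exact: cn [set t : R | t < e] (open_nbhs_nbhs (conj (@open_lt _ e) lt0)).
  apply: filterS => -[w' b] /=.
  by rewrite /partial PsiE -iter_derive_slice.
by apply: filterS2 near1 near2 => b h1 h2; split=> // I w Ir; exact: h2.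
Qed.

(** A neighbourhood contains a finite intersection of subbasic sets around [h b0], so
    [near_subbasic] is applied to each of them. *)
Lemma smooth_family_continuous : continuous h.
Proof.
move=> b0 B; rewrite nbhsE => -[B' [[DD sD DDE] B'b0] B'B].
apply: filterS (B'B) _; move: B'b0; rewrite -DDE => -[S DS Sb0].
have [D' D'sub D'E] := sD _ DS.
suff : \forall b \near b0, S (h b).
  by apply: filterS => b Sb; exists S.
move: Sb0; rewrite -D'E => Sb0.
apply: (filter_bigI (f := fun A => h @^-1` A)) => A AD'.
have [f [c [c' [K [r [e [cK Kc fK e0 AE]]]]]]] := set_mem (D'sub _ AD').
have := Sb0 A AD'; rewrite /= AE.
exact: near_subbasic.
Qed.

End SmoothFamily.

(** * The moduli space *)

Section NonHausdorff.
Local Open Scope classical_set_scope.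
Local Open Scope ring_scope.
Context {R : realType}.
Variables (eps : int) (d md q D mD Q : nat).
Hypothesis heps : eps = 0 \/ eps = 1 \/ eps = -1.
Local Notation M := (@Submfd R d md q (quadric eps q)).
Local Notation N := (@Submfd R D mD Q (quadric eps Q)).

Section Family.
Variables (E : 'M[R]_(d, D)) (xi eta : 'rV[R]_D) (l : 'I_d).
Hypothesis pdotE : forall x y, pdot Q (x *m E) (y *m E) = pdot q x y.
Hypothesis xiE : forall x, pdot Q xi (x *m E) = 0.
Hypothesis etaE : forall x, pdot Q eta (x *m E) = 0.
Hypothesis xi_null : pdot Q xi xi = 0.
Hypothesis eta_null : pdot Q eta eta = 0.
Hypothesis eta_xi : pdot Q eta xi = 2.
Variable x0 : 'rV[R]_d.
Hypothesis quadric_x0 : quadric eps q x0.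
Hypothesis x0l : x0 ord0 l = 0.

Let lft (c : R) : M -> N := lift_map mD l pdotE xiE xi_null c.

Let lift_smooth (c : R) : Cinfty M N :=
  exist _ (lft c) (smooth_lift_map mD l pdotE xiE xi_null c).

Let lift_imm (c : R) : isometric_immersions M N :=
  exist (fun f => f \in [set f : Cinfty M N | isometric (sval f)])
    (lift_smooth c) (mem_set (isometric_lift_map mD l pdotE xiE xi_null c)).

Let lift_smooth_continuous : continuous lift_smooth.
Proof.
apply: (@smooth_family_continuous R M N lift_smooth (lift E xi l)) => //.
by move=> V k U b f; exact: Ck_lift.
Qed.

(** The boost of factor [a] fixes the image of [E] and multiplies [xi] by [a], so it carries [f_b]
    to [f_(ab)]; the factors [c] and [c^-1] give the two congruences. *)
Let orbit_lift c : 0 < c -> orbit_pi (lift_imm c) = orbit_pi (lift_imm 1).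
Proof.
move=> c0; have {}c0 : c != 0 by rewrite gt_eqF.
have boost_lift (a : R) (a0 : a != 0) b :
    lft (a * b) = boost_map xi_null eta_null eta_xi a0 \o lft b.
  apply/funext => x; apply: val_inj; rewrite /= /lift /boost.
  rewrite !(pdotDr, pdotZr) etaE xiE eta_xi xi_null mulr0 !addr0 mulr0 scale0r addr0.
  rewrite -addrA -scalerDl; congr (_ + _ *: _).
  by field.
have ci0 : c^-1 != 0 by rewrite invr_neq0.
apply: eq_orbit_pi.
apply: (@orbit_of_isometry R M N _ _ (boost_map xi_null eta_null eta_xi ci0)
   (boost_map xi_null eta_null eta_xi c0)); try exact: isometry_boost_map.
  by rewrite /imm_fun /= -boost_lift mulVf.
by rewrite /imm_fun /= -boost_lift mulr1.
Qed.

Lemma lift_not_hausdorff : ~ hausdorff_space (moduli_space M N).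
Proof.
move=> hT; have clust : cluster (nbhs (orbit_pi (lift_imm 0) : moduli_space M N))
    (orbit_pi (lift_imm 1)).
  move=> A B; rewrite nbhsE => -[A' [oA' A'0] A'A] B1.
  exists (orbit_pi (lift_imm 1)); split; last exact: (nbhs_singleton B1).
  apply: A'A.
  (* In the subspace topology the preimage of [A'] is the trace of an open set [A2] of [Cinfty M N],
     where the continuity of the family applies. *)
  have [A2 oA2 A2E] : open (@orbit_pi R M N @^-1` A') := open_preimage_orbit_pi oA'.
  have A20 : A2 (lift_smooth 0).
    have : (@orbit_pi R M N @^-1` A') (lift_imm 0) by [].
    by rewrite -A2E.
  have : \forall c \near (0 : R), A2 (lift_smooth c).
    by apply: lift_smooth_continuous; exact: open_nbhs_nbhs.
  move=> /nbhs_ballP[r /= r0 rA].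
  have r20 : 0 < r / 2 by rewrite divr_gt0.
  have : A2 (lift_smooth (r / 2)).
    apply: rA; rewrite /ball /= sub0r normrN ger0_norm ?ltW//.
    by rewrite ltr_pdivrMr// ltr_pMr// ltr1n.
  rewrite -(orbit_lift r20) => h.
  by have : (set_val @^-1` A2) (lift_imm (r / 2)) by []; rewrite A2E.
(* In a Hausdorff space the two classes would coincide, and [lift_imm 1], a member of its own orbit,
   would lie in that of [lift_imm 0]. *)
have : orbit_of (lift_imm 1) (lift_imm 1).
  by exists id => //; exact: isometry_id.
have /= <- := congr1 sval (hT _ _ clust).
move=> [a ia aE].
exact: (lift_map_not_congruent heps etaE eta_xi quadric_x0 x0l ia aE).
Qed.

End Family.

Hypotheses (qd : (q <= d)%N) (qQ : (q < Q)%N) (QD : (Q <= D)%N).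
Hypothesis dqDQ : (d - q < D - Q)%N.

Let emb_subproof (i : 'I_d) : ((if i < q then i : nat else i - q + Q) < D)%N.
Proof. by case: ifP; have := ltn_ord i; lia. Qed.

(** Negative coordinates keep their index; the positive ones are shifted to start at [Q], the first
    positive coordinate of the target. *)
Let emb (i : 'I_d) : 'I_D := Ordinal (emb_subproof i).

Let emb_inj : injective emb.
Proof.
move=> i j /(congr1 val) /=; case: ifP => iq; case: ifP => jq ij; apply: val_inj => //=; lia.
Qed.

Let neg_subproof : (q < D)%N. Proof. lia. Qed.
Let pos_subproof : (D.-1 < D)%N. Proof. lia. Qed.
(** The indices [q] and [D.-1], one negative and one positive, are missed by [emb] and span the
    plane of [xi] and [eta]. *)
Let neg := Ordinal neg_subproof.
Let pos := Ordinal pos_subproof.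

Let E : 'M[R]_(d, D) := \matrix_(i, j) (emb i == j)%:R.

Let mulE_emb (y : 'rV[R]_d) i : (y *m E) ord0 (emb i) = y ord0 i.
Proof.
rewrite mxE (bigD1 i)//= big1 ?addr0 ?mxE ?eqxx ?mulr1// => j ji.
by rewrite mxE (inj_eq emb_inj) (negPf ji) mulr0.
Qed.

Let mulE_out (y : 'rV[R]_d) j : (forall i, emb i != j) -> (y *m E) ord0 j = 0.
Proof.
by move=> ij; rewrite mxE big1// => i _; rewrite mxE (negPf (ij i)) mulr0.
Qed.

Let emb_neg i : emb i != neg.
Proof.
apply/eqP => /(congr1 val) /=; case: ifP => iq ij; lia.
Qed.

Let emb_pos i : emb i != pos.
Proof.
apply/eqP => /(congr1 val) /=; have := ltn_ord i; case: ifP => iq id ij; lia.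
Qed.

Let pdotE (x y : 'rV[R]_d) : pdot Q (x *m E) (y *m E) = pdot q x y.
Proof.
rewrite [x *m E]mulmx_sum_row pdot_suml; apply: eq_bigr => i _.
have -> : row i E = delta_mx ord0 (emb i).
  by apply/rowP => j; rewrite !mxE eqxx /= eq_sym.
rewrite pdotZl pdotC pdot_deltar mulE_emb mulrCA; congr (_ ^+ _ * _).
by rewrite /=; case: ifP => iq; [rewrite (ltn_trans iq qQ)|rewrite ltnNge leq_addl].
Qed.

Lemma space_form_not_hausdorff (l : 'I_d) (x0 : 'rV[R]_d) :
  quadric eps q x0 -> x0 ord0 l = 0 -> ~ hausdorff_space (moduli_space M N).
Proof.
pose xi : 'rV[R]_D := delta_mx ord0 pos + delta_mx ord0 neg.
pose eta : 'rV[R]_D := delta_mx ord0 pos - delta_mx ord0 neg.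
have negQ : (neg < Q)%N = true by [].
have posQ : (pos < Q)%N = false by apply/negbTE; rewrite -leqNgt /=; lia.
have posneg : (pos == neg) = false by apply/negbTE/eqP => /(congr1 val) /=; lia.
have xE x : pdot Q (delta_mx ord0 pos) (x *m E) = 0.
  by rewrite pdotC pdot_deltar mulE_out ?mulr0.
have nE x : pdot Q (delta_mx ord0 neg) (x *m E) = 0.
  by rewrite pdotC pdot_deltar mulE_out ?mulr0.
have pp : pdot Q (delta_mx ord0 pos) (delta_mx ord0 pos) = 1 :> R.
  by rewrite pdot_deltar posQ mxE !eqxx mulr1.
have nn : pdot Q (delta_mx ord0 neg) (delta_mx ord0 neg) = -1 :> R.
  by rewrite pdot_deltar negQ mxE !eqxx mulr1.
have np : pdot Q (delta_mx ord0 neg) (delta_mx ord0 pos) = 0 :> R.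
  by rewrite pdot_deltar mxE posneg andbF mulr0.
have pn : pdot Q (delta_mx ord0 pos) (delta_mx ord0 neg) = 0 :> R.
  by rewrite pdotC.
have etaD : eta = delta_mx ord0 pos + (-1) *: delta_mx ord0 neg.
  by rewrite scaleN1r.
apply: (@lift_not_hausdorff E xi eta l) => //.
- by move=> x; rewrite pdotDl xE nE addr0.
- by move=> x; rewrite etaD pdotDl pdotZl xE nE mulr0 addr0.
- by rewrite !(pdotDl, pdotDr) pp nn np pn; ring.
- by rewrite etaD !(pdotDl, pdotDr, pdotZl, pdotZr) pp nn np pn; ring.
- by rewrite etaD !(pdotDl, pdotDr, pdotZl, pdotZr) pp nn np pn; ring.
Qed.

End NonHausdorff.

Theorem corollary14 (R : realType) (m n s p : nat) (eps : int)
  (hm : (0 < m)%N) (hn : (0 < n)%N) (hsm : (s <= m)%N) (hpn : (p <= n)%N)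
  (hmn : (m + 2 <= n)%N) (hsp : (s + 1 <= p)%N)
  (hpos : (m - s < n - p)%N)
  (heps : eps = 0%R \/ eps = 1%R \/ eps = (-1)%R) :
  ~ hausdorff_space (moduli_space (space_form R m s eps) (space_form R n p eps)).
Proof.
case: (heps) => [e0|[e1|e1]]; subst eps.
(* In the flat case the base point is the origin, with the first coordinate as [l]. *)
- apply: (@space_form_not_hausdorff R 0%R m m s n n p heps hsm _ hpn hpos
    (Ordinal hm) 0%R) => //; first by lia.
  by rewrite mxE.
(* On the sphere the base point is the last basis vector, positive because [s <= m]; [l] is the
   first coordinate, distinct from the last as [0 < m]. *)
- have ne : (ord_max : 'I_m.+1) != ord0 by rewrite -val_eqE /= -lt0n.
  apply: (@space_form_not_hausdorff R 1%R m.+1 m s n.+1 n p heps _ _ _ _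
    ord0 (delta_mx ord0 ord_max)); try lia.
    by rewrite /quadric /= pdot_deltar mxE !eqxx ltnNge hsm mulr1.
  by rewrite mxE eq_sym (negPf ne) andbF.
(* In the hyperbolic case the index [s.+1] makes the first basis vector negative, so it serves as
   base point, and [l] is the last coordinate. *)
- have ne : (ord_max : 'I_m.+1) != ord0 by rewrite -val_eqE /= -lt0n.
  apply: (@space_form_not_hausdorff R (-1)%R m.+1 m s.+1 n.+1 n p.+1 heps _ _ _ _
    ord_max (delta_mx ord0 ord0)); try lia.
    by rewrite /quadric /= pdot_deltar mxE !eqxx mulr1.
  by rewrite mxE (negPf ne) andbF.
Qed.
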